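(* Let $p$ be a prime. If $I_1,\ldots,I_J\subseteq (0,p)$ are disjoint subintervals, with $H/2<|I_j|\le H$ for each $j$, then for any $\ell\in(\mathbb{Z}/p\mathbb{Z})^*$ we have $$\sum_{j=1}^J\left|\sum_{n\in I_j}e\left(\frac{\ell\overline{n}}{p}\right)\right|^2\le 2^{12}\,p\log^2 H.$$
   Context: Here $e(t)=e^{2\pi i t}$, the inner sum runs over the integers $n\in I_j$, $\overline{n}$ denotes the multiplicative inverse of $n$ modulo $p$ (for $p\nmid n$), $|I|$ denotes the length of an interval $I$, $\log$ is the natural logarithm, and $\log^2 H$ means $(\log H)^2$.
   Formalization: The bound is proved under the extra assumption |log H| ≥ 1/32, because as written it fails for H near 1 (for H = 1 and the single interval [1/2, 3/2] the left side is 1 and the right side is 0). *)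

(* Defs.v *)
(* MathComp / MathComp-Analysis, with complex numbers from mathcomp-real-closed. *)
From HB Require Import structures.
From mathcomp Require Export all_boot all_order all_algebra.
From mathcomp Require Export complex.
From mathcomp Require Export all_classical all_reals all_analysis.

Set Implicit Arguments.
Unset Strict Implicit.
Unset Printing Implicit Defensive.

Import Order.TTheory GRing.Theory Num.Theory.
Local Open Scope ring_scope.
Local Open Scope complex_scope.

Definition e {R : realType} (t : R) : R[i] :=
  cos (2 * pi * t) +i* sin (2 * pi * t).

Definition cabs {R : realType} (z : R[i]) : R := ComplexField.Normc.normc z.

(* The argument of [e] uses the representative in [0, p) of ell * n^-1 in 'F_p;
   since e has period 1, the choice of representative is immaterial.  The
   range 1 <= n < p contains every integer of I as soon as I is included in
   (0, p), and n%:R is then invertible in 'F_p for p prime. *)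
Definition short_kloosterman {R : realType} (p : nat) (ell : 'F_p)
    (I : set R) : R[i] :=
  \sum_(1 <= n < p | (n%:R : R) \in I)
    e ((nat_of_ord (ell / (n%:R : 'F_p)))%:R / p%:R).

(* Main.v *)
Require Import Defs.
From mathcomp Require Import all_solvable all_field zify ring lra.

(* Write K(a, b) = sum_(x != 0) e((a x + b / x) / p), f(n) = e(ell / n / p) and
   S(x, h) = sum_(x <= n < x + h) f(n).

   Weil's bound |K(a, b)|^2 <= 4 p.  Over the tower of fields with
   q_j = p^(2^j) elements, the Kloosterman sums K_j of the character
   composed with the trace satisfy K_(j+1) = 2 q_j - K_j^2: this is the
   part of the rationality of the L-function that only sees polynomials
   of degree 2.  Hence t_j = - K_j / sqrt q_j satisfies t_(j+1) = t_j^2 - 2;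
   it is at least -2 from then on, and unbounded if K_0^2 > 4 p.  On the
   other hand the sum of the t_j over all nontrivial characters is bounded
   above, because a x + b / x has trace 0 as soon as it is y^p - y for
   some y, which is a quadratic equation for x of discriminant
   (y^p - y)^2 - 4 a b, and Stepanov's method shows that this discriminant
   is a nonzero square for at least q/2 - O(sqrt q) values of y.

   By Parseval, sum_x |S(x, h)|^2 <= 4 p h for every h.  If T_h(I) is the
   sum of the S(x, h) over all translates [x, x + h) contained in an
   interval I, then T_h(I) / h - T_2h(I) / 2h only involves translates near
   the extremities of I, and its square is at most
   V_h(I) = sum_([x, x + h) in I) |S(x, h)|^2 / h.  Telescoping over h = 2^i
   gives |T_1(I)|^2 <= M sum_(i < M) V_(2^i)(I) for |I| < 2^M, and the V_h(I_j)
   add up to at most 4 p over disjoint I_j.  The total 4 p M^2 is enough for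
   H >= 2; for H < 2 each I_j contains at most two integers. *)

Set Implicit Arguments.
Unset Strict Implicit.
Unset Printing Implicit Defensive.

Import Order.TTheory GRing.Theory Num.Theory.
Local Open Scope classical_set_scope.
Local Open Scope ring_scope.

(** * Polynomials in positive characteristic *)

(** Pigeonhole: two arguments with the same image differ by a nonzero kernel element. It serves as a
    dimension count for linear systems. *)
Lemma additive_kernel (U V : finZmodType) (f : U -> V) :
  {morph f : x y / x - y} -> (#|V| < #|U|)%N -> exists2 u, u != 0 & f u = 0.
Proof.
move=> fB ltVU; have /injectivePn[x [y neq_xy fxy]] : ~~ injectiveb f.
  by apply/negP => /injectiveP/leq_card; rewrite leqNgt ltVU.
by exists (x - y); rewrite ?subr_eq0 // fB fxy subrr.
Qed.

Lemma exprBn_pchar (R : comNzRingType) (p k : nat) (x y : R) :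
  p \in [pchar R] -> (x - y) ^+ (p ^ k) = x ^+ (p ^ k) - y ^+ (p ^ k).
Proof.
move=> chR; elim: k => [|k IHk]; first by rewrite !expr1.
by rewrite expnSr !exprM IHk -!(pFrobenius_autE chR) rmorphB.
Qed.

Section RowPart.
Variables (R : nzRingType) (P : nat).
Implicit Types h : {poly R}.

(* h = sum_(i < P) X^i * rowpart B i h if size h <= B P.  Modulo (X - x)^P with P
   a power of the characteristic, X^P is the constant x^P, so that the rowparts
   can be evaluated at x. *)
Definition rowpart (B i : nat) h : {poly R} :=
  \sum_(b < B) h`_(b * P + i) *: 'X^(b * P).

Lemma rowpartB B i : {morph rowpart B i : h1 h2 / h1 - h2}.
Proof.
by move=> h1 h2; rewrite /rowpart -sumrB; apply: eq_bigr => b _;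
  rewrite coefB scalerBl.
Qed.

Lemma size_rowpart B i h : (size (rowpart B i h) <= size h)%N.
Proof.
apply: leq_trans (size_sum _ _ _) _; apply/bigmax_leqP => b _.
have [le_h|lt_h] := leqP (size h) (b * P + i).
  by rewrite nth_default // scale0r size_poly0.
apply: leq_trans (size_scale_leq _ _) _; rewrite size_polyXn.
by apply: leq_ltn_trans lt_h; rewrite leq_addr.
Qed.
End RowPart.

Section PolyFrobenius.
Variables (F : fieldType) (p k : nat).
Hypothesis chF : p \in [pchar F].
Local Notation P := (p ^ k)%N.
Implicit Types (x : F) (h : {poly F}).

Lemma pchar_polyF : p \in [pchar {poly F}].
Proof. by rewrite pchar_poly. Qed.

(** The difference is (h - h(x))^P, and X - x divides h - h(x). *)
Lemma dvdp_exp_Frobenius x h :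
  ('X - x%:P) ^+ P %| h ^+ P - (h.[x] ^+ P)%:P.
Proof.
rewrite polyC_exp -(exprBn_pchar _ _ _ pchar_polyF).
by apply: dvdp_exp2r; rewrite dvdp_XsubCl rootE !hornerE subrr.
Qed.

(** Induction on [B] splits off the lowest [P] coefficients; what remains carries a factor X^P,
    congruent to x^P. *)
Lemma dvdp_rowpart B x h : (size h <= B * P)%N ->
  ('X - x%:P) ^+ P %| h - \sum_(i < P) (rowpart P B i h).[x] *: 'X^i.
Proof.
elim: B h => [|B IHB] h szh.
  move: szh; rewrite size_poly_leq0 => /eqP->.
  rewrite big1 ?subrr ?dvdp0 // => i _.
  by rewrite /rowpart big_ord0 horner0 scale0r.
have sz_drop : (size (drop_poly P h) <= B * P)%N.
  by rewrite size_drop_poly; move: szh; rewrite mulSn; lia.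
have -> : \sum_(i < P) (rowpart P B.+1 i h).[x] *: 'X^i = take_poly P h +
   x ^+ P *: \sum_(i < P) (rowpart P B i (drop_poly P h)).[x] *: 'X^i.
  rewrite scaler_sumr /take_poly poly_def -big_split; apply: eq_bigr => i _ /=.
  rewrite /rowpart big_ord_recl mul0n expr0 add0n alg_polyC hornerD hornerC.
  rewrite scalerDl scalerA; congr (_ + _ *: _).
  rewrite !horner_sum mulr_sumr; apply: eq_bigr => b _.
  rewrite !hornerE coef_drop_poly /= /bump /= add1n mulSn.
  by rewrite exprD mulrA [x ^+ P * _]mulrC -addnA [(P + _)%N]addnC.
set T := \sum_(i < P) _.
have -> : h - (take_poly P h + x ^+ P *: T) =
    (drop_poly P h - T) * 'X^P + T * ('X^P - (x ^+ P)%:P).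
  rewrite -{1}(poly_take_drop P h) -mul_polyC.
  by rewrite mulrBl mulrBr [T * _%:P]mulrC opprD addrACA subrr add0r addrA subrK.
apply: dvdp_add; first by apply: dvdp_mulr; exact: IHB.
by apply: dvdp_mull; have := dvdp_exp_Frobenius x 'X; rewrite hornerX.
Qed.
End PolyFrobenius.

(** If r were nonzero, r and s could be made coprime; then r is constant, s^2 divides g,
    separability makes s constant, and so g would be constant. *)
Lemma separable_mul_sqr (F : fieldType) (g r s : {poly F}) (c : F) :
    coprimep g g^`() -> (1 < size g)%N -> g * r ^+ 2 = c *: s ^+ 2 -> r = 0.
Proof.
move=> sep_g g_gt1 E; apply/eqP/negPn/negP => r0.
have g0 : g != 0 by rewrite -size_poly_gt0 (ltn_trans _ g_gt1).
have c0 : c != 0.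
  apply/eqP => c0; move/eqP: E.
  by rewrite c0 scale0r mulf_eq0 expf_eq0 /= (negPf g0) (negPf r0).
have d0 : gcdp r s != 0 by rewrite gcdp_eq0 (negPf r0).
set d := gcdp r s in d0.
have Er : r = (r %/ d) * d by rewrite divpK // dvdp_gcdl.
have Es : s = (s %/ d) * d by rewrite divpK // dvdp_gcdr.
have cop : coprimep (r %/ d) (s %/ d) by rewrite coprimep_div_gcd // r0.
move: E; rewrite {1}Er {1}Es; move: (r %/ d) (s %/ d) cop => r1 s1 cop.
rewrite !exprMn mulrA scalerAl => /(mulIf (expf_neq0 2 d0)) E.
have : r1 ^+ 2 %| s1 ^+ 2.
  by rewrite -(dvdpZr _ _ c0) -E dvdp_mull.
rewrite -[s1 ^+ 2]mul1r Gauss_dvdpl; last first.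
  by rewrite coprimep_expl // coprimep_expr.
rewrite dvdp1 => /eqP/eqP; rewrite size_poly_eq1 => r1_unit.
have s1g : s1 ^+ 2 %| g.
  rewrite -(dvdpZl _ _ c0) -E -[X in _ %| X]mulr1 dvdp_mul2l //.
  by rewrite (eqp_dvdl _ r1_unit).
have s1_1 : s1 %= 1.
  have [q Eg] : exists q, g = q * s1 ^+ 2 by apply/dvdpP.
  rewrite -size_poly_eq1 -dvdp1; move: sep_g; rewrite coprimep_def => sg.
  have : s1 %| gcdp g g^`().
    rewrite dvdp_gcd Eg expr2 !derivM dvdp_mull ?dvdp_mulr //=.
    apply: dvdp_add; apply: dvdp_mull; first exact: dvdp_mull.
    by apply: dvdp_add; [exact: dvdp_mull | exact: dvdp_mulr].
  by move=> /dvdp_trans; apply; rewrite dvdp1.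
have : size (g * r1 ^+ 2) = size (c *: s1 ^+ 2) by rewrite E.
rewrite (size_scale _ c0).
have -> : size (s1 ^+ 2) = 1.
  by apply/eqP; rewrite size_poly_eq1; have := eqp_exp 2 s1_1; rewrite expr1n.
have [a a0 ->] : exists2 a, a != 0 & r1 ^+ 2 = a%:P.
  by apply/size_poly1P; rewrite size_poly_eq1.
by rewrite mulrC mul_polyC size_scale // => g1; rewrite g1 in g_gt1.
Qed.

(** * Stepanov's method for y^2 = g(x) *)

Lemma size_polyM_leq (R : nzSemiRingType) (h1 h2 : {poly R}) u v :
  (size h1 <= u.+1)%N -> (size h2 <= v)%N -> (size (h1 * h2)%R <= v + u)%N.
Proof. by move=> le1 le2; apply: leq_trans (size_polyMleq _ _) _; lia. Qed.

Section Stepanov.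
Variables (F : finFieldType) (p k P e m : nat) (g : {poly F}) (a : F).
(** With [P = 2e + 1] and q = [P * P], [c] is (q - 1) / 2, so g(x)^c is the quadratic character of
    g(x). The size bound [d] keeps g r^2 and s^2 below degree q, [J] makes the unknowns outnumber
    the conditions, and [M] bounds the size of each condition. *)
Local Notation c := (e * P.+1)%N.
Local Notation d := (c - m)%N.
Local Notation J := (e + m).+2.
Local Notation M := (d + J + m * P)%N.
Hypothesis chF : p \in [pchar F].
Hypothesis cardF : #|F| = (P * P)%N.
Hypothesis PE : P = (p ^ k)%N.
Hypothesis Pe : P = e.*2.+1.
Hypothesis size_g : size g = m.*2.+1.
Hypothesis sep_g : coprimep g g^`().
Hypothesis g0 : g.[0] != 0.
Hypothesis m_gt0 : (0 < m)%N.
Hypothesis a0 : a != 0.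
Hypothesis leP : (m.+1 ^ 2 <= P)%N.

Implicit Types (x : F) (A : 'M[F]_(J + J, d)) (j : 'I_J).

Let G := g ^+ e.
Let rA A j := rVpoly (row (lshift J j) A).
Let sA A j := rVpoly (row (rshift J j) A).

(* Write r_j = rA A j, s_j = sA A j, and let N = (X - x)^P with g(x)^c = a.
   Modulo N, a P-th power h(X)^P is the constant h(x)^P; as c = e (P + 1), this
   gives X^(P * P) = x and G(x) g^c = a G, hence
   G(x) * stepanov_poly = sum_j (G(x) r_j + a G s_j) x^j.
   The coefficients of X^i in the right-hand side, X^P being replaced by x^P,
   are the values at x of stepanov_cond i: when these vanish, so does
   stepanov_poly to order P at x.  No derivative is needed. *)
Definition stepanov_cond A i : {poly F} :=
  \sum_(j < J) (G * rowpart P M i (rA A j)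
                + a *: rowpart P M i (G * sA A j)) * 'X^j.

Definition stepanov_poly A : {poly F} :=
  \sum_(j < J) (rA A j + sA A j * g ^+ c) * 'X^(j * (P * P)).

Let size_rA A j : (size (rA A j) <= d)%N. Proof. exact: size_poly. Qed.
Let size_sA A j : (size (sA A j) <= d)%N. Proof. exact: size_poly. Qed.

Let size_gX n : (size (g ^+ n) <= (m.*2 * n).+1)%N.
Proof. by have := size_poly_exp_leq g n; rewrite size_g. Qed.

Let size_G : (size G <= (m * P).+1)%N.
Proof. by apply: leq_trans (size_gX e) _; nia. Qed.

Lemma size_stepanov_cond A i : (size (stepanov_cond A i) <= M)%N.
Proof.
apply: leq_trans (size_sum _ _ _) _; apply/bigmax_leqP => j _.
set T := (X in X * _).
suff szT : (size T <= (d + m * P).-1.+1)%N.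
  apply: leq_trans (size_polyM_leq szT (leqnn _)) _.
  by rewrite size_polyXn; have := ltn_ord j; lia.
have d_gt0 : (0 < d)%N by move: Pe leP; nia.
rewrite prednK ?addn_gt0 ?d_gt0 // /T.
apply: leq_trans (size_polyD _ _) _; rewrite geq_max; apply/andP; split.
  apply: size_polyM_leq size_G _.
  exact: leq_trans (size_rowpart P M i (rA A j)) (size_rA A j).
apply: leq_trans (size_scale_leq _ _) _.
by apply: leq_trans (size_rowpart _ _ _ _) _; exact: size_polyM_leq.
Qed.

(* There are 2 J d unknown coefficients and P M linear conditions. *)
Lemma stepanov_kernel :
  exists2 A : 'M[F]_(J + J, d), A != 0 & forall i, (i < P)%N -> stepanov_cond A i = 0.
Proof.
pose f A : 'M[F]_(P, M) := \matrix_(i < P) poly_rV (stepanov_cond A i).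
have condB i : {morph stepanov_cond^~ i : A B / A - B}.
  move=> A B; rewrite /stepanov_cond -sumrB; apply: eq_bigr => j _.
  rewrite /rA /sA !(linearB, rowpartB) /= !mulrBr !rowpartB scalerBr -mulrBl.
  by rewrite opprD addrACA.
have [||A A0 fA0] := @additive_kernel 'M[F]_(J + J, d) 'M[F]_(P, M) f.
- by move=> A B; apply/row_matrixP => i; rewrite linearB /= !rowK condB linearB.
- rewrite !card_mx cardF ltn_exp2l; last by move: Pe leP; nia.
  by move: Pe leP m_gt0; nia.
exists A => // i ltiP.
have := congr1 (row (Ordinal ltiP)) fA0; rewrite rowK linear0 /= => E.
by rewrite -(poly_rV_K (size_stepanov_cond A i)) E linear0.
Qed.

Let cardF' : #|F| = (p ^ (k + k))%N.
Proof. by rewrite cardF PE expnD. Qed.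

Let d_gt0 : (0 < d)%N. Proof. by move: Pe leP; nia. Qed.

(** Strong induction on [j]: if all earlier r and s vanish, X^q divides r + s g^c, where q =
    [P * P]. Multiplying by (r - s g^c) g gives g r^2 - s^2 g^q, and g^q is g(0) modulo X^q. By size
    g r^2 = g(0) s^2, which forces r = s = 0 as g is separable. *)
Lemma stepanov_poly_neq0 A : A != 0 -> stepanov_poly A != 0.
Proof.
apply: contraNneq => r0.
have step j0 : (forall j, (j < j0)%N -> (rA A j == 0) && (sA A j == 0)) ->
    (rA A j0 == 0) && (sA A j0 == 0).
  move=> lt0; set r := rA A j0; set s := sA A j0.
  have dvd1 : 'X^(P * P) %| r + s * g ^+ c.
    rewrite -(@dvdp_mul2l _ 'X^(j0 * (P * P))) ?monic_neq0 ?monicXn //.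
    have -> : 'X^(j0 * (P * P)) * (r + s * g ^+ c) =
       - (\sum_(j < J | j != j0) (rA A j + sA A j * g ^+ c) * 'X^(j * (P * P))).
      apply/eqP; rewrite -addr_eq0 mulrC -[X in _ == X]r0 /stepanov_poly.
      by rewrite [X in _ == X](bigD1 j0) //= eqxx.
    rewrite dvdpNr -exprD; set N := 'X^_.
    apply: (big_ind (fun h => N %| h)) => [|h1 h2|j neq_j]; first exact: dvdp0.
      exact: dvdp_add.
    have [lt_j|ge_j] := ltnP j j0.
      by have /andP[/eqP-> /eqP->] := lt0 j lt_j; rewrite mul0r addr0 mul0r dvdp0.
    apply: dvdp_mull; rewrite dvdp_exp2l //.
    have : (j0 < j)%N by rewrite ltn_neqAle ge_j eq_sym andbT.
    by rewrite [(_ + P * P)%N]addnC -mulSn => lt_j; rewrite leq_mul2r lt_j orbT.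
  have cE : (c + c).+1 = (P * P)%N by rewrite Pe; lia.
  have dvd2 : 'X^(P * P) %| g * r ^+ 2 - g.[0] *: s ^+ 2.
    have := dvdp_mulr ((r - s * g ^+ c) * g) dvd1.
    have -> : (r + s * g ^+ c) * ((r - s * g ^+ c) * g) =
       (g * r ^+ 2 - g.[0] *: s ^+ 2) - s ^+ 2 * (g ^+ (P * P) - (g.[0])%:P).
      rewrite -cE [g ^+ _.+1]exprS exprD -mul_polyC; set y := g ^+ c; ring.
    rewrite dvdp_addl // dvdpNr dvdp_mull //.
    have := dvdp_exp_Frobenius (k + k) chF 0 g.
    by rewrite -{3}cardF' expf_card expnD -PE subr0.
  have E0 : g * r ^+ 2 = g.[0] *: s ^+ 2.
    apply/eqP; rewrite -subr_eq0; apply: contraTT dvd2 => /dvdp_leq lt_sz.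
    apply/negP => /lt_sz; rewrite size_polyXn leqNgt.
    have sq (h : {poly F}) : (size h <= d)%N -> (size (h ^+ 2) <= d + d.-1)%N.
      by move=> szh; rewrite expr2 size_polyM_leq ?prednK.
    apply/negP/negPn; apply: leq_ltn_trans (size_polyD _ _) _.
    rewrite size_polyN gtn_max; apply/andP; split.
      have := @size_polyM_leq _ g (r ^+ 2) m.*2 (d + d.-1).
      rewrite size_g (sq r (size_rA A j0)) => /(_ (leqnn _) isT) szgr.
      by apply: leq_ltn_trans szgr _; lia.
    apply: leq_ltn_trans (size_scale_leq _ _) _.
    by apply: leq_ltn_trans (sq s (size_sA A j0)) _; lia.
  have rz : r = 0 by apply: (separable_mul_sqr sep_g _ E0); rewrite size_g; lia.
  move/eqP: E0; rewrite rz expr0n mulr0 eq_sym scaler_eq0 (negPf g0) expf_eq0 /=.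
  by rewrite eqxx.
have all0 n j : (j < n)%N -> (rA A j == 0) && (sA A j == 0).
  elim: n j => [//|n IHn] j lt_j; apply: step => i lt_i; apply: IHn.
  exact: leq_trans lt_i _.
apply/eqP/row_matrixP => i; rewrite row0 -[row i A]rVpolyK.
case: (split_ordP i) => j ->.
  by have /andP[/eqP E _] := all0 _ j (ltn_ord j); rewrite [rVpoly _]E linear0.
by have /andP[_ /eqP E] := all0 _ j (ltn_ord j); rewrite [rVpoly _]E linear0.
Qed.

Lemma stepanov_poly_dvdp A x :
    (forall i, (i < P)%N -> stepanov_cond A i = 0) -> g.[x] ^+ c = a ->
  ('X - x%:P) ^+ P %| stepanov_poly A.
Proof.
move=> A0 gx; set N := _ ^+ P; set y := G.[x].
(* Here y = g(x)^e, so y^(P + 1) = g(x)^c = a is nonzero; this allows the final division by y. *)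
have yP : y * y ^+ P = a by rewrite -exprS /y /G horner_exp -exprM.
have y0 : y != 0 by apply: contraNneq a0 => y0; rewrite -yP y0 mul0r.
have N_sum (H : 'I_J -> {poly F}) : (forall j, N %| H j) -> N %| \sum_j H j.
  by move=> NH; apply: (big_ind (fun h => N %| h)) => *; rewrite ?dvdp0 ?dvdp_add.
have N_XQ j : N %| 'X^(j * (P * P)) - (x ^+ j)%:P.
  have := dvdp_exp_Frobenius (k + k) chF x 'X^j.
  rewrite -{3}cardF' expf_card expnD -PE hornerXn -exprM.
  by apply: dvdp_trans; rewrite dvdp_exp2l // leq_pmulr ?Pe.
have N_GP : N %| G ^+ P - (y ^+ P)%:P.
  by have := dvdp_exp_Frobenius k chF x G; rewrite -PE.
pose h j := y%:P * rA A j + a%:P * (G * sA A j).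
have cong : N %| y%:P * stepanov_poly A - \sum_j h j * (x ^+ j)%:P.
  rewrite mulr_sumr -sumrB; apply: N_sum => j.
  have -> : g ^+ c = G * G ^+ P by rewrite -exprS -exprM.
  rewrite /h -[in a%:P]yP !(polyCM, polyC_exp).
  set r := rA A j; set s := sA A j; set X' := 'X^(_); set x' := x%:P ^+ j.
  have -> : y%:P * ((r + s * (G * G ^+ P)) * X') -
      (y%:P * r + y%:P * y%:P ^+ P * (G * s)) * x' =
      y%:P * (r + s * (G * G ^+ P)) * (X' - x') +
      y%:P * s * G * x' * (G ^+ P - y%:P ^+ P) by ring.
  by rewrite dvdp_add // dvdp_mull // /x' -polyC_exp ?N_XQ.
have part (w : {poly F}) : (size w <= M)%N ->
    N %| w - \sum_(i < P) (rowpart P M i w).[x] *: 'X^i.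
  move=> szw; rewrite /N PE; apply: dvdp_rowpart => //; rewrite -PE.
  by apply: leq_trans szw _; rewrite leq_pmulr ?Pe.
have cong2 : N %| \sum_j h j * (x ^+ j)%:P.
  have sum0 : \sum_(i < P) (stepanov_cond A i).[x] *: 'X^i = 0 :> {poly F}.
    by rewrite big1 // => i _; rewrite A0 // horner0 scale0r.
  suff : N %| \sum_j h j * (x ^+ j)%:P
      - \sum_(i < P) (stepanov_cond A i).[x] *: 'X^i by rewrite sum0 subr0.
  have -> : \sum_(i < P) (stepanov_cond A i).[x] *: 'X^i =
      \sum_j (y%:P * \sum_(i < P) (rowpart P M i (rA A j)).[x] *: 'X^i + 
       a%:P * \sum_(i < P) (rowpart P M i (G * sA A j)).[x] *: 'X^i) * (x ^+ j)%:P.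
    under eq_bigr => i _ do rewrite horner_sum scaler_suml.
    rewrite exchange_big; apply: eq_bigr => j _ /=.
    rewrite !mulr_sumr -big_split mulr_suml; apply: eq_bigr => i _ /=.
    rewrite /y /G !hornerE -!mul_polyC !(polyCM, polyCD); ring.
  rewrite -sumrB; apply: N_sum => j; rewrite -mulrBl dvdp_mulr // /h.
  rewrite opprD addrACA -!mulrBr dvdp_add // dvdp_mull // part //.
    by apply: leq_trans (size_rA A j) _; lia.
  by apply: leq_trans (size_polyM_leq size_G (size_sA A j)) _; lia.
have := dvdp_add cong cong2; rewrite subrK mul_polyC.
by rewrite dvdpZr.
Qed.

Lemma size_stepanov_poly A :
  (size (stepanov_poly A) <= (e + m).+1 * (P * P) + (d + m.*2 * c))%N.
Proof.
apply: leq_trans (size_sum _ _ _) _; apply/bigmax_leqP => j _.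
set T := (X in X * _).
have szT : (size T <= (d + m.*2 * c).-1.+1)%N.
  rewrite prednK ?addn_gt0 ?d_gt0 //.
  apply: leq_trans (size_polyD _ _) _; rewrite geq_max; apply/andP; split.
    by apply: leq_trans (size_rA A j) _; rewrite leq_addr.
  by rewrite mulrC size_polyM_leq ?size_gX.
apply: leq_trans (size_polyM_leq szT (leqnn _)) _.
rewrite size_polyXn addSnnS prednK ?addn_gt0 ?d_gt0 // leq_add2r leq_mul2r.
by rewrite -ltnS ltn_ord orbT.
Qed.

(** Each solution is a zero of order at least [P] of a nonzero [stepanov_poly A], so [P] times their
    number is at most its degree. *)
Theorem stepanov_bound :
  (2 * #|[pred x | g.[x] ^+ c == a]| <= P * P + P * (4 * m + 3))%N.
Proof.
have [A A0 condA] := stepanov_kernel.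
have r0 := stepanov_poly_neq0 A0.
set Z := #|_|; set s := enum [pred x | g.[x] ^+ c == a].
have sZ : size s = Z by rewrite -cardE.
have dvd (t : seq F) : uniq t -> {subset t <= s} ->
    (\prod_(x <- t) ('X - x%:P)) ^+ P %| stepanov_poly A.
  elim: t => [|x t IHt] /=; first by rewrite big_nil expr1n dvd1p.
  case/andP=> xt ut sub; rewrite big_cons exprMn Gauss_dvdp; last first.
    rewrite coprimep_expl // coprimep_expr // coprimep_sym coprimep_XsubC.
    by rewrite root_prod_XsubC.
  rewrite IHt // ?andbT; last by move=> z zt; apply: sub; rewrite inE zt orbT.
  apply: stepanov_poly_dvdp => //; apply/eqP.
  by have := sub x (mem_head _ _); rewrite mem_enum inE.
have := leq_trans (leq_pred _) (dvdp_leq r0 (dvd s (enum_uniq _) (fun _ => id))).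
rewrite size_exp size_prod_XsubC sZ /= => leZ.
have {}leZ := leq_trans leZ (size_stepanov_poly A).
by move: leZ Pe leP m_gt0; nia.
Qed.
End Stepanov.

(** * Elements of trace zero of the form a x + b / x *)

Lemma card_roots (F : finFieldType) (h : {poly F}) n :
  h != 0 -> (size h <= n.+1)%N -> (#|[pred x | root h x]| <= n)%N.
Proof.
move=> h0 szh; rewrite cardE -ltnS; apply: leq_trans szh.
apply: max_poly_roots => //; last exact: enum_uniq.
by apply/allP => x; rewrite mem_enum.
Qed.

(** Euler's criterion: z is s^i for a generator s of the multiplicative group, and z^c = 1 forces i
    to be even. *)
Lemma Euler_sqr (F : finFieldType) (c : nat) (z : F) :
  #|F| = (c * 2).+1 -> z ^+ c = 1 -> exists w, w ^+ 2 = z.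
Proof.
move=> cF zc; have c_gt0 : (0 < c)%N.
  by case: c cF {zc} => // cF; have := finNzRing_gt1 F; rewrite cF.
have /hasP[s _ prim_s] : has (c * 2).-primitive_root (enum (predC1 (0 : F))).
  apply: has_prim_root => //; first by rewrite muln_gt0 c_gt0.
  - apply/allP => x; rewrite mem_enum !inE => x0; apply/unity_rootP.
    by apply: (mulfI x0); rewrite -exprS -cF expf_card mulr1.
  - exact: enum_uniq.
  - by rewrite -cardE cardC1 cF.
have [i zi] : {i : 'I_(c * 2) | z = s ^+ i}.
  by apply: prim_rootP prim_s _ _; rewrite exprM zc expr1n.
have : (c * 2 %| c * i)%N.
  by rewrite (prim_order_dvd prim_s) [(c * i)%N]mulnC exprM -zi zc eqxx.
rewrite dvdn_pmul2l // => /dvdnP[q iq].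
by exists (s ^+ q); rewrite -exprM -iq -zi.
Qed.

Section FrobeniusTrace.
Variables (F : fieldType) (p : nat).
Hypothesis chF : p \in [pchar F].

(** On the field with [p ^ n] elements, this is the trace to the prime field. *)
Definition ftrace n (z : F) := \sum_(i < n) z ^+ (p ^ i).

Lemma expD_pchar i : {morph (fun z : F => z ^+ (p ^ i)) : x y / x + y}.
Proof.
move=> x y /=; apply: exprDn_pchar.
by rewrite pnatX (eq_pnat _ (pcharf_eq chF)) pnat_id // (pcharf_prime chF).
Qed.

Lemma ftraceD n : {morph ftrace n : x y / x + y}.
Proof.
by move=> x y; rewrite /ftrace -big_split; apply: eq_bigr => i _; rewrite expD_pchar.
Qed.

Lemma ftraceB n : {morph ftrace n : x y / x - y}.
Proof.
move=> x y; rewrite /ftrace -sumrB; apply: eq_bigr => i _.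
by rewrite exprBn_pchar.
Qed.

Lemma ftrace_Frobenius n z : ftrace n (z ^+ p) + z = ftrace n z + z ^+ (p ^ n).
Proof.
rewrite /ftrace; under eq_bigr => i _ do rewrite -exprM -expnS.
by rewrite addrC -[LHS](big_ord_recl n (fun i => z ^+ (p ^ i))) big_ord_recr.
Qed.
End FrobeniusTrace.

Section ArtinSchreierCount.
Variables (F : finFieldType) (p k : nat) (a b : F).
Local Notation P := (p ^ k)%N.
Hypothesis chF : p \in [pchar F].
Hypothesis oddp : odd p.
Hypothesis cardF : #|F| = (P * P)%N.
Hypothesis leP : (p.+1 ^ 2 <= P)%N.
Hypothesis a0 : a != 0.
Hypothesis b0 : b != 0.

(** [g] is the discriminant of a x^2 - u x + b, that is, of u = a x + b / x as an equation for x;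
    [c] is (q - 1) / 2 for q = [P * P]. *)
Let u : {poly F} := 'X^p - 'X.
Let g : {poly F} := u ^+ 2 - (4%:R * a * b)%:P.
Let c := (P./2 * P.+1)%N.

Let p_pr : prime p. Proof. exact: pcharf_prime chF. Qed.
Let p_gt2 : (2 < p)%N.
Proof. by rewrite odd_prime_gt2. Qed.

Let D0 : 4%:R * a * b != 0.
Proof.
rewrite !mulf_neq0 // -(dvdn_pcharf chF) -[4%N]/(2 ^ 2)%N Euclid_dvdX //.
by rewrite gtnNdvd.
Qed.

Let size_u : size u = p.+1.
Proof. by rewrite size_polyDl size_polyXn // size_polyN size_polyX; lia. Qed.

Let size_g : size g = p.*2.+1.
Proof.
have sz2 : size (u ^+ 2) = p.*2.+1.
  have : (size (u ^+ 2)).-1 = (p * 2)%N by rewrite size_exp size_u.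
  have : u ^+ 2 != 0 by rewrite expf_neq0 // -size_poly_gt0 size_u.
  by rewrite -size_poly_gt0; lia.
by rewrite /g size_polyDl sz2 // size_polyN size_polyC; case: (_ == _) => /=; lia.
Qed.

Let g_neq0 : g != 0. Proof. by rewrite -size_poly_gt0 size_g. Qed.

(** In characteristic p, u' = -1 and g' = -2u, so -2g - u g' is the nonzero constant 8ab. *)
Let sep_g : coprimep g g^`().
Proof.
have du : u^`() = -1.
  rewrite /u derivB derivX derivXn.
  by rewrite -mulr_natl (pcharf0 (pchar_polyF chF)) mul0r sub0r.
have dg : g^`() = (- 2%:R) * u.
  rewrite /g derivB derivC subr0 expr2 derivM du; ring.
apply/Bezout_coprimepP; exists (- 2%:R, - u) => /=.
have -> : - 2%:R * g + - u * g^`() = (2%:R * (4%:R * a * b))%:P.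
  by rewrite dg /g polyCM; ring.
by rewrite -size_poly_eq1 size_polyC mulf_neq0 // -(dvdn_pcharf chF) gtnNdvd.
Qed.

Let Pe : P = (P./2).*2.+1.
Proof. by rewrite -[LHS]odd_double_half oddX oddp orbT. Qed.

(** The values g(y)^c are 1, -1 or 0. Stepanov's method bounds the number of values -1 from above
    and the degree of [g] that of zeros, which leaves a lower bound for the value 1. *)
Lemma card_good_disc :
  (P * P <= 2 * #|[pred y | g.[y] ^+ c == 1%R]| + (P * (4 * p + 3) + 4 * p))%N.
Proof.
have neg : (2 * #|[pred x | g.[x] ^+ c == (-1)%R]| <= P * P + P * (4 * p + 3))%N.
  apply: (@stepanov_bound F p k P P./2 p g (-1)) => //.
  - rewrite /g /u !hornerE expr0n (gtn_eqF (ltnW (ltnW p_gt2))).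
    by rewrite subrr expr0n /= sub0r oppr_eq0.
  - exact: ltnW (ltnW p_gt2).
  - by rewrite oppr_eq0 oner_eq0.
have zer : (#|[pred x | root g x]| <= p.*2)%N by rewrite card_roots ?size_g.
suff : (P * P <= #|[pred y | g.[y] ^+ c == 1%R]| + #|[pred x | g.[x] ^+ c == (-1)%R]|
         + #|[pred x | root g x]|)%N by lia.
rewrite -cardF -!sum1_card /=.
rewrite [X in (_ <= X + _ + _)%N]big_mkcond [X in (_ <= _ + X + _)%N]big_mkcond.
rewrite [X in (_ <= _ + _ + X)%N]big_mkcond -!big_split /=.
apply: leq_sum => x _; rewrite !inE rootE.
have [//|gx0] := eqVneq g.[x] 0; rewrite ?addn1 //.
have : (g.[x] ^+ c - 1) * (g.[x] ^+ c + 1) == 0.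
  rewrite -subr_sqr expr1n subr_eq0 -exprM; apply/eqP.
  apply: (mulfI gx0); rewrite mulr1 -exprS.
  have -> : (c * 2).+1 = #|F| by rewrite cardF Pe /c Pe; nia.
  exact: expf_card.
rewrite mulf_eq0 subr_eq0 addr_eq0.
by case: (_ == 1); case: (_ == -1).
Qed.

Let trF : F -> F := ftrace p (k + k).

(** Double count of the points of y^p - y = a x + b / x: a y with g(y) a nonzero square has two x,
    while an x has at most p values of y, and none unless the trace is 0. *)
Lemma card_trace0 :
  (P * P <= p * #|[pred x : F | (x != 0) && (trF (a * x + b / x) == 0)]%R|
     + (P * (4 * p + 3) + 4 * p))%N.
Proof.
apply: leq_trans card_good_disc _; rewrite leq_add2r.
pose on_curve (x y : F) := (x != 0) && (y ^+ p - y == a * x + b / x).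
apply: (@leq_trans (\sum_y \sum_x on_curve x y)).
  rewrite mulnC -sum_nat_const big_mkcond; apply: leq_sum => y _ /=.
  case: ifPn => // /eqP gy.
  have [w gw] : exists w, w ^+ 2 = g.[y].
    by apply: (@Euler_sqr F c) gy; rewrite cardF Pe /c Pe; nia.
  have c_gt0 : (0 < c)%N by rewrite /c; move: Pe leP; nia.
  have w0 : w != 0.
    apply: contra_eq_neq gy => w0; rewrite -gw w0 expr0n /= expr0n.
    by rewrite (gtn_eqF c_gt0) eq_sym oner_eq0.
  pose v := y ^+ p - y.
  have gv : w ^+ 2 = v ^+ 2 - 4%:R * a * b by rewrite gw /g /u !hornerE.
  have n2 : 2%:R != 0 :> F by rewrite -(dvdn_pcharf chF) gtnNdvd.
  have n4 : 4%:R != 0 :> F by rewrite -[4%:R]/(2 * 2)%:R natrM mulf_neq0.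
  (* The quadratic formula, applied below to s = w and s = -w, which are distinct. *)
  have sol s : s ^+ 2 = v ^+ 2 - 4%:R * a * b -> on_curve ((v + s) / (2%:R * a)) y.
    move=> sv; set x := _ / _.
    have xE : v * x = a * x ^+ 2 + b.
      have -> : b = (v ^+ 2 - s ^+ 2) / (4%:R * a).
        by rewrite sv; field; rewrite a0 n4.

      by rewrite /x; field; rewrite ?a0 ?n2 ?n4.
    have x0 : x != 0.
      by apply: contra_eq_neq xE => ->; rewrite mulr0 expr0n mulr0 add0r eq_sym.
    rewrite /on_curve x0 /= -/v; apply/eqP; apply: (mulIf x0); rewrite xE.
    by rewrite mulrDl divfK // expr2 mulrA.
  rewrite (bigD1 ((v + w) / (2%:R * a))) //= sol //.
  rewrite (bigD1 ((v - w) / (2%:R * a))) /=; first by rewrite sol ?sqrrN.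
  rewrite -subr_eq0 -mulrBl mulf_neq0 ?invr_eq0 ?mulf_neq0 //.
  have -> : v - w - (v + w) = - (2%:R * w) by ring.
  by rewrite oppr_eq0 mulf_neq0.
rewrite exchange_big mulnC -sum_nat_const [leqRHS]big_mkcond /=.
apply: leq_sum => x _; rewrite inE /on_curve.
have [//|x0] /= := eqVneq x 0; first by rewrite big1.
set v := a * x + b / x.
case: ifPn => [_|tr_v]; last first.
  (* The trace of y^p - y telescopes to y^q - y = 0. *)
  rewrite big1 // => y _; apply/eqP; rewrite eqb0; apply: contra tr_v => /eqP<-.
  rewrite /trF ftraceB // subr_eq0; apply/eqP.
  have := ftrace_Frobenius p (k + k) y.
  by rewrite expnD -cardF expf_card => /addIr->.
have -> : (\sum_y (y ^+ p - y == v)%R)%N = #|[pred y | y ^+ p - y == v]|.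
  by rewrite -sum1_card [RHS]big_mkcond; apply: eq_bigr => y _; rewrite inE; case: eqP.
pose h : {poly F} := u - v%:P.
have sz_h : size h = p.+1.
  by rewrite /h size_polyDl size_u // size_polyN size_polyC; case: (_ == _) => /=; lia.
apply: leq_trans (card_roots (h := h) (n := p) _ _); last by rewrite sz_h.
  by apply: subset_leq_card; apply/fintype.subsetP => y;
    rewrite !inE rootE /h /u !hornerE subr_eq0.
by rewrite -size_poly_gt0 sz_h.
Qed.
End ArtinSchreierCount.

(** * Kloosterman sums in a quadratic extension *)

(** X^q - X divides every X^(q^n) - X, in particular the product of all X - x over F; hence it has q
    distinct roots in F. *)
Lemma card_fixed_Frobenius (F : finFieldType) (p k r : nat) :
    p \in [pchar F] -> (0 < k)%N -> #|F| = ((p ^ k) ^ r)%N ->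
  #|[pred x : F | x ^+ (p ^ k) == x]| = (p ^ k)%N.
Proof.
move=> chF k_gt0 cardF; set q := (p ^ k)%N in cardF *.
have q_gt1 : (1 < q)%N by rewrite -(exp1n k) ltn_exp2r // (prime_gt1 (pcharf_prime chF)).
pose h n : {poly F} := 'X^(q ^ n) - 'X.
have size_h : size (h 1) = q.+1.
  by rewrite /h expn1 size_polyDl size_polyXn // size_polyN size_polyX.
have h0 : h 1 != 0 by rewrite -size_poly_gt0 size_h.
have rootE x : root (h 1) x = (x ^+ q == x).
  by rewrite rootE /h expn1 !hornerE subr_eq0.
apply/eqP; rewrite eqn_leq; apply/andP; split.
  rewrite -(eq_card (A := [pred x | root (h 1) x])); last by move=> x; rewrite !inE.
  by rewrite card_roots ?size_h.
have dvd n : h 1 %| h n.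
  elim: n => [|n IHn]; first by rewrite /h expr1 subrr dvdp0.
  have -> : h n.+1 = h n ^+ q + h 1.
    rewrite /h exprBn_pchar ?pchar_polyF // -/q expn1 -exprM -expnSr.
    by rewrite addrA subrK.
  by rewrite dvdp_add // dvdp_exp // ltnW // ltnW.
have := dvd r; rewrite /h -cardF finField_genPoly => /dvdp_prod_XsubC[m].
set s := mask m _ => hs.
have us : uniq s by rewrite mask_uniq // index_enum_uniq.
have qs : q = size s.
  by apply: succn_inj; rewrite -size_h (eqp_size hs) size_prod_XsubC.
rewrite {1}qs -(card_uniqP us); apply: subset_leq_card; apply/fintype.subsetP => x xs.
by rewrite inE -rootE (eqp_root hs) root_prod_XsubC.
Qed.

Section QuadraticStep.
Variables (E : finFieldType) (p k : nat) (C : fieldType) (lam : E -> C) (a b : E).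
Local Notation q := (p ^ k)%N.
Hypothesis chE : p \in [pchar E].

Let fixE (x y : E) : x ^+ q = x -> y ^+ q = y -> (x + y) ^+ q = x + y.
Proof. by move=> xq yq; rewrite expD_pchar // xq yq. Qed.

Let fixV (x : E) : x ^+ q = x -> (x^-1) ^+ q = x^-1.
Proof. by move=> xq; rewrite exprVn xq. Qed.

Let fixM (x y : E) : x ^+ q = x -> y ^+ q = y -> (x * y) ^+ q = x * y.
Proof. by move=> xq yq; rewrite exprMn xq yq. Qed.

Hypothesis lam0 : lam 0 = 1.
Hypothesis lamD : forall x y, x ^+ q = x -> y ^+ q = y ->
  lam (x + y) = lam x * lam y.
Hypothesis lam_nontriv : exists2 z, z ^+ q = z & lam z != 1.

(** Translating s by z / t multiplies the sum by [lam z], which is not 1. *)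
Lemma sum_char_fixed (t : E) : t ^+ q = t -> t != 0 ->
  \sum_(s | s ^+ q == s) lam (s * t) = 0.
Proof.
move=> tq t0; have [z zq lz] := lam_nontriv.
set S := \sum_(_ | _) _; apply/eqP.
have : S = lam z * S.
  rewrite mulr_sumr /S (reindex_inj (addIr (z / t))) /=.
  have ztq : (z / t) ^+ q = z / t by rewrite fixM ?fixV.
  apply: eq_big => s; first by rewrite expD_pchar // ztq (inj_eq (addIr _)).
  move=> /eqP sq; have {}sq : s ^+ q = s.
    by apply: (addIr (z / t)); rewrite -{1}ztq -expD_pchar.
  by rewrite mulrDl divfK // addrC lamD // fixM.
move/eqP; rewrite -subr_eq0 -{1}[S]mul1r -mulrBl mulf_eq0 subr_eq0 eq_sym.
by rewrite (negPf lz).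
Qed.

Hypothesis q_gt0 : (0 < k)%N.
Hypothesis card_q : #|[pred x : E | x ^+ q == x]| = q.
Hypothesis card_q2 : #|[pred x : E | x ^+ (q * q) == x]| = (q * q)%N.
Hypothesis aq : a ^+ q = a.
Hypothesis bq : b ^+ q = b.
Hypothesis a0 : a != 0.
Hypothesis b0 : b != 0.

(** [m1] sends a pair from F_q^* to (sum, product) and [m2] sends z in F_(q^2)^* to (trace, norm).
    Both f x + f y and f z + f z^q equal a s + b s / m at the image (s, m), so the character value
    is [w (s, m)]; [n1] and [n2] count the fibres. *)
Let f (x : E) := a * x + b / x.
Let w (sm : E * E) := lam (a * sm.1 + b * sm.1 / sm.2).
Let B (sm : E * E) := (sm.1 ^+ q == sm.1) && ((sm.2 ^+ q == sm.2) && (sm.2 != 0)).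
Let A1 (xy : E * E) := ((xy.1 ^+ q == xy.1) && (xy.1 != 0)) &&
                       ((xy.2 ^+ q == xy.2) && (xy.2 != 0)).
Let A2 (z : E) := (z ^+ (q * q) == z) && (z != 0).
Let m1 (xy : E * E) := (xy.1 + xy.2, xy.1 * xy.2).
Let m2 (z : E) := (z + z ^+ q, z * z ^+ q).
Let n1 sm := #|[pred xy | A1 xy & m1 xy == sm]|.
Let n2 sm := #|[pred z | A2 z & m2 z == sm]|.

Let A1B xy : A1 xy -> B (m1 xy).
Proof.
case: xy => x y /andP[/andP[/eqP /= xq x0] /andP[/eqP /= yq y0]].
by rewrite /B /= fixE // fixM // !eqxx mulf_neq0.
Qed.

Let A2B z : A2 z -> B (m2 z).
Proof.
case/andP=> /eqP zqq z0; have zq : (z ^+ q) ^+ q = z by rewrite -exprM.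
rewrite /B /= expD_pchar // exprMn zq addrC mulrC !eqxx mulf_neq0 //.
exact: expf_neq0.
Qed.

(* The roots of x (s - x) = m are permuted by x -> x^q, so that x^q is x or
   s - x; both happen only for a double root. *)
Let n12_le2 sm : (n1 sm + n2 sm <= 2)%N.
Proof.
case: sm => s m.
pose r1 := [pred x : E | (x ^+ q == x) && (x * (s - x) == m)].
pose r2 := [pred x : E | (x ^+ q == s - x) && (x * (s - x) == m)].
have le1 : (n1 (s, m) <= #|r1|)%N.
  rewrite /n1 -(@card_in_image _ _ (@fst E E)).
    apply: subset_leq_card; apply/fintype.subsetP => z /fintype.imageP[[x y]].
    rewrite !inE => /andP[/andP[/andP[/eqP /= xq _] _]].
    by rewrite /m1 /= => /eqP[<- <-] ->; rewrite xq addrAC subrr add0r !eqxx.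
  move=> [x y] [x' y']; rewrite !inE => /andP[_ /eqP[E1 _]] /andP[_ /eqP[E1' _]] /= xx.
  by move: E1'; rewrite -E1 xx => /addrI ->.
have le2 : (n2 (s, m) <= #|r2|)%N.
  apply: subset_leq_card; apply/fintype.subsetP => z; rewrite !inE.
  by move=> /andP[_ /eqP[<- <-]]; rewrite addrAC subrr add0r !eqxx.
apply: leq_trans (leq_add le1 le2) _.
have [/existsP[x0 /eqP x0m]|/existsPn no] :=
  boolP [exists x, x * (s - x) == m]; last first.
  rewrite [#|r1|]eq_card0 ?[#|r2|]eq_card0 // => x;
  by rewrite !inE (negPf (no x)) andbF.
have rootsE x : x * (s - x) == m -> (x == x0) || (x == s - x0).
  rewrite -x0m -subr_eq0 -(subr_eq0 x x0) -(subr_eq0 x) -mulf_eq0 -oppr_eq0.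
  by have -> : - (x * (s - x) - x0 * (s - x0)) = (x - x0) * (x - (s - x0)) by ring.
have [ss|neq] := eqVneq x0 (s - x0).
  have le1x (r : {pred E}) : {subset r <= [pred x | x * (s - x) == m]} -> (#|r| <= 1)%N.
    move=> sub; rewrite -(card1 x0); apply: subset_leq_card.
    apply/fintype.subsetP => x xr.
    by have /rootsE := sub x xr; rewrite -ss orbb.
  by apply: (@leq_add _ _ 1 1); apply: le1x => x; rewrite !inE => /andP[].
rewrite -cardUI [#|predI _ _|]eq_card0 ?addn0 => [|x]; last first.
  rewrite !inE; apply/negP => /andP[/andP[/eqP-> xm] /andP[/eqP xs _]].
  case/orP: (rootsE x xm) => /eqP xE; first by rewrite -xE -xs eqxx in neq.
  by move: neq; rewrite -xE xs xE subKr eqxx.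
apply: (@leq_trans #|pred2 x0 (s - x0)|); last by rewrite card2 neq.
apply: subset_leq_card; apply/fintype.subsetP => x.
by rewrite !inE => /orP[] /andP[_] /rootsE.
Qed.

(* On average over (s, m) this count is exactly 2. *)
Let n12_eq2 sm : B sm -> (n1 sm + n2 sm = 2)%N.
Proof.
have card_nz n : (0 < n)%N -> #|[pred x : E | x ^+ n == x]| =
    #|[pred x : E | (x ^+ n == x) && (x != 0)]|.+1.
  move=> n_gt0; rewrite (cardD1 0) inE expr0n (gtn_eqF n_gt0) eqxx add1n.
  by congr (_.+1); apply: eq_card => x; rewrite !inE andbC.
have q_pos : (0 < q)%N by rewrite expn_gt0 prime_gt0 ?(pcharf_prime chE).
have card_q' : #|[pred x : E | (x ^+ q == x) && (x != 0)]| = q.-1.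
  by rewrite -[in RHS]card_q card_nz.
have tot1 : (\sum_(sm | B sm) n1 sm = q.-1 * q.-1)%N.
  transitivity #|[pred xy | A1 xy]|.
    rewrite -sum1_card [RHS](partition_big m1 B) => [|xy]; last exact: A1B.
    apply: eq_bigr => sm' _; rewrite /n1 -sum1_card.
    by apply: eq_bigl => xy; rewrite !inE.
  by rewrite -card_q' -cardX; apply: eq_card => -[x y]; rewrite !inE.
have tot2 : (\sum_(sm | B sm) n2 sm = (q * q).-1)%N.
  transitivity #|[pred z | A2 z]|.
    rewrite -sum1_card [RHS](partition_big m2 B) => [|z]; last exact: A2B.
    apply: eq_bigr => sm' _; rewrite /n2 -sum1_card.
    by apply: eq_bigl => z; rewrite !inE.
  by rewrite -[in RHS]card_q2 card_nz ?muln_gt0 ?q_pos.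
have cardB : (\sum_(sm | B sm) 2 = 2 * (q * q.-1))%N.
  rewrite sum_nat_const mulnC; congr (_ * _)%N.
  rewrite -card_q' -[X in (X * _)%N]card_q -cardX.
  by apply: eq_card => -[x y]; rewrite !inE.
(* All terms are at most 2 and their total equals that of the constant 2, so each term is 2. *)
have leB sm' : B sm' -> (n1 sm' + n2 sm' <= 2 ?= iff (n1 sm' + n2 sm' == 2))%N.
  by move=> _; split; first exact: n12_le2.
have [_] := leqif_sum leB; rewrite big_split /= tot1 tot2 cardB.
have -> : (q.-1 * q.-1 + (q * q).-1 = 2 * (q * q.-1))%N by nia.
rewrite eqxx => /esym/forallP all2 Bsm; apply/eqP.
by have := all2 sm; rewrite Bsm.
Qed.

(** Grouped by (s, m), the left side is twice the sum of lam (s (a + b / m)). The sum over s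
    vanishes unless m = - b / a, where it is q. *)
Lemma quadratic_step :
  (\sum_(x | (x ^+ q == x) && (x != 0)) lam (f x)) ^+ 2 +
  \sum_(z | (z ^+ (q * q) == z) && (z != 0)) lam (f z + f z ^+ q) = (2 * q)%:R.
Proof.
have -> : (\sum_(x | (x ^+ q == x) && (x != 0)) lam (f x)) ^+ 2 =
    \sum_(sm | B sm) w sm *+ n1 sm.
  rewrite expr2 mulr_suml; under eq_bigr => x _ do rewrite mulr_sumr.
  rewrite pair_big (partition_big m1 B) => [|xy]; last exact: A1B.
  apply: eq_bigr => sm _; rewrite -sumr_const /=; apply: eq_big => [xy|xy].
    by rewrite !inE.
  case: xy => x y /andP[/andP[/andP[/eqP /= xq x0] /andP[/eqP /= yq y0]]] /eqP<-.
  rewrite -lamD ?fixE ?fixM ?fixV // /w /f /=; congr lam; field.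
  by rewrite x0 y0.
have -> : \sum_(z | (z ^+ (q * q) == z) && (z != 0)) lam (f z + f z ^+ q) =
    \sum_(sm | B sm) w sm *+ n2 sm.
  rewrite (partition_big m2 B) => [|z]; last exact: A2B.
  apply: eq_bigr => sm _; rewrite -sumr_const /=; apply: eq_big => [z|z].
    by rewrite !inE.
  case/andP=> /andP[_ z0] /eqP<-.
  rewrite /w /f expD_pchar // !exprMn exprVn aq bq /=; congr lam; field.
  by rewrite z0 expf_neq0.
rewrite -big_split /=.
transitivity (\sum_(sm | B sm) w sm *+ 2).
  by apply: eq_bigr => sm Bsm; rewrite -mulrnDr n12_eq2.
rewrite sumrMnl -[LHS]mulr_natl natrM; congr (_ * _).
pose Bm (m : E) := (m ^+ q == m) && (m != 0).
transitivity (\sum_(m | Bm m) \sum_(s | s ^+ q == s) lam (s * (a + b / m))).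
  rewrite exchange_big pair_big /=; apply: eq_big => [[s m] //|[s m] _].
  rewrite /w /=; congr lam; ring.
have fix0 : (- b / a) ^+ q = - b / a.
  rewrite fixM ?fixV //; have := @exprBn_pchar _ p k 0 b chE.
  by rewrite !sub0r bq expr0n expn_eq0 (gtn_eqF (prime_gt0 (pcharf_prime chE))) /= sub0r.
rewrite (bigD1 (- b / a)) /=; last first.
  by rewrite /Bm fix0 eqxx mulf_neq0 ?oppr_eq0 ?invr_eq0.
rewrite [X in _ + X]big1 ?addr0 => [|m /andP[/andP[/eqP mq m0] neq]].
  have -> : a + b / (- b / a) = 0 by field; rewrite ?oppr_eq0 ?a0 ?b0.
  under eq_bigr => s _ do rewrite mulr0 lam0.
  by rewrite sumr_const card_q.
apply: sum_char_fixed; first by rewrite fixE ?fixM ?fixV.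
apply: contra neq; rewrite addr_eq0 => /eqP abm; apply/eqP.
apply: (mulIf a0); rewrite divfK // abm mulrN mulrC divfK // .
Qed.
End QuadraticStep.

(** * The tower of quadratic extensions *)

Section AddChar.
Variables (p : nat) (C : fieldType) (w : C).
Hypothesis p_pr : prime p.
Hypothesis prim_w : p.-primitive_root w.
Implicit Types s t : 'F_p.

Definition psi t : C := w ^+ (t : nat).

Lemma psi0 : psi 0 = 1. Proof. exact: expr0. Qed.

Lemma psiD s t : psi (s + t) = psi s * psi t.
Proof.
rewrite /psi -exprD -[RHS](prim_expr_mod prim_w) /=; congr (w ^+ _).
by rewrite [X in (_ %% X)%N]Fp_cast.
Qed.

Lemma psi_eq1 t : (psi t == 1) = (t == 0).
Proof.
rewrite /psi -(prim_order_dvd prim_w) -val_eqE /=.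
have := ltn_ord t; rewrite [X in (_ < X)%N]Fp_cast // => lt_tp.
case: (posnP (t : nat)) => [->|t_gt0]; first by rewrite dvdn0.
by rewrite gtnNdvd // gtn_eqF.
Qed.

Lemma sum_psi t : \sum_c psi (c * t) = if t == 0 then p%:R else 0.
Proof.
case: eqP => [->|/eqP t0].
  under eq_bigr => c _ do rewrite mulr0 psi0.
  by rewrite sumr_const card_Fp.
set S := \sum_c _; apply/eqP.
have : S = psi t * S.
  rewrite {1}/S (reindex_inj (addIr 1)) mulr_sumr; apply: eq_bigr => c _.
  by rewrite mulrDl mul1r psiD mulrC.
move/eqP; rewrite -subr_eq0 -{1}[S]mul1r -mulrBl mulf_eq0 subr_eq0 eq_sym.
by rewrite psi_eq1 (negPf t0).
Qed.

Definition kloosterman (a b : 'F_p) : C := \sum_(x | x != 0) psi (a * x + b / x).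

End AddChar.

Section Tower.
Variables (p N : nat) (C : fieldType) (w : C) (E0 : finFieldType).
Hypothesis p_pr : prime p.
Hypothesis prim_w : p.-primitive_root w.
Hypothesis chE : p \in [pchar E0].
Hypothesis cardE : #|E0| = (p ^ (2 ^ N))%N.
Variables (a b : 'F_p).
Hypothesis a0 : a != 0.
Hypothesis b0 : b != 0.

Local Notation E := (pPrimeCharType chE).
Let emb (t : 'F_p) : E := t%:A.
Local Notation psi := (@psi p C w).

Let chE' : p \in [pchar E]. Proof. exact: chE. Qed.

(** The inverse of [emb] on the prime subfield, where traces lie; the default 0 is taken
    elsewhere. *)
Definition prime_part (x : E) : 'F_p := odflt 0 [pick t : 'F_p | emb t == x].

Let emb_inj : injective emb.
Proof. exact: (@fmorph_inj _ _ (in_alg E)). Qed.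

Lemma prime_partK t : prime_part (emb t) = t.
Proof.
rewrite /prime_part; case: pickP => [s /eqP /emb_inj //|/(_ t)].
by rewrite eqxx.
Qed.

Let embX t n : emb t ^+ n = emb (t ^+ n).
Proof. by rewrite -[LHS](rmorphXn (in_alg E)). Qed.

Let emb_fixed t j : emb t ^+ (p ^ j) = emb t.
Proof.
rewrite embX; congr (emb _); elim: j => [|j IHj]; first by rewrite expr1.
by rewrite expnSr exprM IHj -[X in _ ^+ X](card_Fp p_pr) expf_card.
Qed.

Let card_fixed j : (j <= N)%N ->
  #|[pred x : E | x ^+ (p ^ (2 ^ j)) == x]| = (p ^ (2 ^ j))%N.
Proof.
move=> le_jN; apply: (@card_fixed_Frobenius E p (2 ^ j) (2 ^ (N - j))) => //.
  by rewrite expn_gt0.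
by rewrite -expnM -expnD subnKC.
Qed.

(** The image of [emb] has p elements, as many as there are solutions of x^p = x. *)
Lemma fixed_emb (x : E) : x ^+ p = x -> exists t, x = emb t.
Proof.
move=> xp; have sub : codom emb \subset [pred y : E | y ^+ p == y].
  apply/fintype.subsetP => _ /codomP[t ->]; rewrite inE; apply/eqP.
  exact: (emb_fixed t 1).
have /subset_leqif_card[_] := sub.
have c0 : #|[pred x : E | x ^+ p == x]| = p := card_fixed (leq0n N).
rewrite card_codom // card_Fp // c0 eqxx => /esym/fintype.subsetP/(_ x).
by rewrite inE xp eqxx => /(_ isT)/codomP.
Qed.

Lemma prime_partD (x y : E) : x ^+ p = x -> y ^+ p = y ->
  prime_part (x + y) = prime_part x + prime_part y.
Proof.
move=> /fixed_emb[s ->] /fixed_emb[t ->].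
have -> : emb s + emb t = emb (s + t) by rewrite /emb scalerDl.
by rewrite !prime_partK.
Qed.

Lemma prime_part_eq0 (x : E) : x ^+ p = x -> (prime_part x == 0) = (x == 0).
Proof.
move=> /fixed_emb[s ->]; rewrite prime_partK.
by rewrite -[in RHS](scale0r (1 : E)) (inj_eq emb_inj).
Qed.

Let tr j : E -> E := ftrace p (2 ^ j).

Lemma tr_fixed j u : u ^+ (p ^ (2 ^ j)) = u -> tr j u ^+ p = tr j u.
Proof.
move=> uq; have := ftrace_Frobenius p (2 ^ j) u; rewrite uq => /addIr E1.
rewrite -[RHS]E1 /tr /ftrace -(pFrobenius_autE chE') rmorph_sum /=.
by apply: eq_bigr => i _; rewrite pFrobenius_autE -!exprM mulnC.
Qed.

Let lam j (c : 'F_p) u := psi (c * prime_part (tr j u)).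

Let lam0 j c : lam j c 0 = 1.
Proof.
rewrite /lam; suff -> : prime_part (tr j 0) = 0 by rewrite mulr0 psi0.
have z0 : tr j 0 = 0.
  rewrite /tr /ftrace big1 // => i _; rewrite expr0n expn_eq0.
  by rewrite (gtn_eqF (prime_gt0 p_pr)).
by apply/eqP; rewrite prime_part_eq0 z0 // expr0n (gtn_eqF (prime_gt0 p_pr)).
Qed.

Let lamD j c x y : x ^+ (p ^ (2 ^ j)) = x -> y ^+ (p ^ (2 ^ j)) = y ->
  lam j c (x + y) = lam j c x * lam j c y.
Proof.
move=> xq yq; rewrite /lam /tr ftraceD // prime_partD; try exact: tr_fixed.
by rewrite mulrDr psiD.
Qed.

(** Otherwise the trace polynomial, of degree [p ^ (2 ^ j).-1], would vanish at [p ^ (2 ^ j)]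
    points. *)
Let lam_nontriv j c : (j <= N)%N -> c != 0 ->
  exists2 z, z ^+ (p ^ (2 ^ j)) = z & lam j c z != 1.
Proof.
move=> le_jN c0.
have [/existsP[z /andP[/eqP zq tz]]|/existsPn no] :=
  boolP [exists z : E, (z ^+ (p ^ (2 ^ j)) == z) && (tr j z != 0)].
  exists z => //; rewrite /lam psi_eq1 // mulf_neq0 // prime_part_eq0 //.
  exact: tr_fixed.
pose h : {poly E} := \sum_(i < 2 ^ j) 'X^(p ^ i).
have e2 : (2 ^ j = (2 ^ j).-1.+1)%N by rewrite prednK // expn_gt0.
have sz_h : size h = (p ^ (2 ^ j).-1).+1.
  have gen n : size (\sum_(i < n.+1) 'X^(p ^ i) : {poly E}) = (p ^ n).+1.
    rewrite big_ord_recr /= addrC size_polyDl size_polyXn //.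
    rewrite ltnS; apply: leq_trans (size_sum _ _ _) _; apply/bigmax_leqP => i _.
    by rewrite size_polyXn ltn_exp2l ?prime_gt1.
  by rewrite -gen -e2.
have h0 : h != 0 by rewrite -size_poly_gt0 sz_h.
have := card_roots h0 (n := p ^ (2 ^ j).-1); rewrite sz_h ltnSn => /(_ isT).
have : (p ^ (2 ^ j).-1 < p ^ (2 ^ j))%N by rewrite ltn_exp2l ?prime_gt1 // {2}e2.
rewrite -(card_fixed le_jN) => lt1 le2; have := leq_ltn_trans le2 lt1.
rewrite ltnNge => /negP[]; apply: subset_leq_card; apply/fintype.subsetP => z.
rewrite !inE => zq; have := no z; rewrite zq /= negbK => /eqP tz.
rewrite rootE /h horner_sum; apply/eqP; rewrite -[RHS]tz.
by apply: eq_bigr => i _; rewrite hornerXn.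
Qed.

Let f (x : E) := emb a * x + emb b / x.
Let K j c := \sum_(x | (x ^+ (p ^ (2 ^ j)) == x) && (x != 0)) lam j c (f x).

Let emb0 : emb 0 = 0. Proof. exact: scale0r. Qed.

(** This is [quadratic_step], since the trace of u at level j + 1 is the trace at level j of u +
    u^q. *)
Let K_step j c : (j < N)%N -> c != 0 ->
  K j.+1 c = (2 * p ^ (2 ^ j))%:R - K j c ^+ 2.
Proof.
move=> lt_jN c0; apply/eqP; rewrite eq_sym subr_eq addrC; apply/eqP.
have qq : (p ^ (2 ^ j) * p ^ (2 ^ j) = p ^ (2 ^ j.+1))%N.
  by rewrite -expnD expnS mul2n addnn.
have emb_neq0 t : t != 0 -> emb t != 0 by rewrite -emb0 (inj_eq emb_inj).
have := @quadratic_step E p (2 ^ j) C (lam j c) (emb a) (emb b) chE'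
  (lam0 j c) (@lamD j c) (lam_nontriv (ltnW lt_jN) c0).
rewrite qq expn_gt0 => /(_ isT (card_fixed (ltnW lt_jN)) (card_fixed lt_jN)
  (emb_fixed _ _) (emb_fixed _ _) (emb_neq0 _ a0) (emb_neq0 _ b0)) <-.
congr (_ + _); apply: eq_bigr => z _; rewrite /lam; congr (psi (c * prime_part _)).
rewrite -/(f z) /tr ftraceD // /ftrace expnS mul2n -addnn big_split_ord /=.
by congr (_ + _); apply: eq_bigr => i _; rewrite -exprM -expnD.
Qed.

Let K0E c : K 0 c = kloosterman w (c * a) (c * b).
Proof.
have embE t : emb t = in_alg E t by [].
have emb_fix (x : E) : x ^+ (p ^ (2 ^ 0)) == x -> emb (prime_part x) = x.
  by move=> /eqP/(@fixed_emb x)[t ->]; rewrite prime_partK.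
rewrite /K /kloosterman (reindex_onto emb prime_part) => [|x /andP[/emb_fix]//].
apply: eq_big => [t|t /andP[/andP[_ t0] _]].
  by rewrite prime_partK emb_fixed !eqxx andbT -emb0 (inj_eq emb_inj).
have -> : f (emb t) = emb (a * t + b / t).
  by rewrite /f !embE rmorphD !rmorphM fmorphV.
rewrite /lam /tr /ftrace expn0 big_ord1 expr1 prime_partK mulrDr !mulrA //.
Qed.

Let sum_K : \sum_c K N c =
  (p * #|[pred x : E | (x != 0) && (tr N (f x) == 0)]|)%:R.
Proof.
have fixT (x : E) : x ^+ (p ^ (2 ^ N)) = x.
  by rewrite -[RHS]expf_card; congr (_ ^+ _); rewrite -cardE.
rewrite /K exchange_big /= natrM mulrC mulr_natl -sumr_const big_mkcond [RHS]big_mkcond.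
apply: eq_bigr => x _; rewrite inE fixT eqxx /=.
have [//|x0] /= := eqVneq x 0.
by rewrite sum_psi // prime_part_eq0 // tr_fixed.
Qed.

Hypothesis N_gt0 : (0 < N)%N.
Hypothesis p_odd : odd p.
Hypothesis p_small : (p.+1 ^ 2 <= p ^ (2 ^ N.-1))%N.

(** The sum over all c is p times the number of x of trace 0, by orthogonality; removing c = 0
    subtracts q - 1. Describing [kap] by its recursion frees it from the field [E0]. *)
Lemma kloosterman_tower (kap : nat -> 'F_p -> C) :
    (forall c, kap 0 c = kloosterman w (c * a) (c * b)) ->
    (forall j c, kap j.+1 c = (2 * p ^ (2 ^ j))%:R - kap j c ^+ 2) ->
  exists2 m : nat, \sum_(c | c != 0) kap N c = m%:R - (p ^ (2 ^ N))%:R + 1 &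
    (p ^ (2 ^ N) <= m + (p ^ (2 ^ N.-1) * (4 * p + 3) + 4 * p))%N.
Proof.
move=> kap0 kapS; exists (p * #|[pred x : E | (x != 0) && (tr N (f x) == 0)]%R|)%N.
  have KE j c : (j <= N)%N -> c != 0 -> kap j c = K j c.
    elim: j => [|j IHj] le_jN c0; first by rewrite kap0 K0E.
    by rewrite kapS K_step // IHj // ltnW.
  under eq_bigr => c c0 do rewrite KE //.
  have KN0 : K N 0 = (p ^ (2 ^ N))%:R - 1.
    rewrite /K (eq_bigl (fun x => x != 0)) => [|x]; last first.
      by rewrite -[X in _ == X]expf_card -{1}cardE eqxx.
    under eq_bigr => x _ do rewrite /lam mul0r psi0.
    rewrite sumr_const cardC1 -[#|_|]/#|E0| cardE.
    by rewrite -subn1 natrB ?expn_gt0 ?prime_gt0.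
  rewrite -sum_K [X in X - _](bigD1 (0 : 'F_p)) //= [X in X + _ - _]KN0; ring.
have e2 : (2 ^ N = 2 ^ N.-1 + 2 ^ N.-1)%N by rewrite addnn -mul2n -expnS prednK.
have emb_neq0 t : t != 0 -> emb t != 0 by rewrite -emb0 (inj_eq emb_inj).
have := @card_trace0 E p (2 ^ N.-1) (emb a) (emb b) chE' p_odd.
rewrite -expnD -e2 cardE => /(_ erefl p_small (emb_neq0 _ a0) (emb_neq0 _ b0)).
by [].
Qed.
End Tower.

(** * Weil's bound *)

(** If t_0 = 2 + d with d > 0, then t_n - 2 is at least (n + 1) d, because t^2 - 4 = (t - 2)^2 + 4
    (t - 2). *)
Lemma doubling_bounded (R : archiRealFieldType) (t : nat -> R) (B : R) (m : nat) :
    (forall n, t n.+1 = t n ^+ 2 - 2) -> (forall n, t (m + n)%N <= B) ->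
  t 0%N <= 2.
Proof.
move=> tS tB; rewrite leNgt; apply/negP => t0.
pose d := t 0%N - 2; have d0 : 0 < d by rewrite /d; lra.
have grow n : n.+1%:R * d <= t n - 2.
  elim: n => [|n IHn]; first by rewrite mul1r.
  have le_d : d <= n.+1%:R * d by rewrite -{1}[d]mul1r ler_pM2r // ler1n.
  rewrite tS -natr1 mulrDl mul1r; have := sqr_ge0 (t n - 2); nra.
have [n lt_n] : exists n, B / d < n%:R.
  by exists (Num.bound (B / d)); exact: unstable.ltr_bound.
have := grow (m + n)%N; have := tB n; move: lt_n.
rewrite ltr_pdivrMr // => lt_n tB' grow'.
have : n%:R * d <= (m + n).+1%:R * d by rewrite ler_pM2r // ler_nat; lia.
by lra.
Qed.

Section Weil.
Variables (R : realType) (p : nat) (w : R[i]).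
Hypothesis p_pr : prime p.
Hypothesis prim_w : p.-primitive_root w.

Lemma norm_psi (t : 'F_p) : `|psi w t| = 1 :> R[i].
Proof.
apply/eqP; rewrite -(pexpr_eq1 (n := p)) ?prime_gt0 //.
by rewrite -normrX /psi exprAC (prim_expr_order prim_w) expr1n normr1.
Qed.

Lemma conj_psi (t : 'F_p) : (psi w t)^* = psi w (- t).
Proof.
have t0 : psi w t != 0 by rewrite -normr_eq0 norm_psi oner_eq0.
apply: (mulfI t0); rewrite -normCK norm_psi expr1n.
by rewrite -psiD // subrr psi0.
Qed.

Lemma kloosterman_real (a b : 'F_p) : kloosterman w a b \is Num.real.
Proof.
rewrite CrealE /kloosterman rmorph_sum /=; apply/eqP.
rewrite (reindex_inj oppr_inj); apply: eq_big => t; first by rewrite oppr_eq0.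
by move=> _; rewrite conj_psi invrN !mulrN -opprD opprK.
Qed.

Theorem weil_kloosterman (a b : 'F_p) : a != 0 -> b != 0 ->
  `|kloosterman w a b| ^+ 2 <= (4 * p)%:R.
Proof.
move=> a0 b0.
have [p2|p_odd] := even_prime p_pr.
  apply: le_trans (_ : 1 <= _); last by rewrite ler1n p2.
  rewrite expr_le1 // /kloosterman; apply: le_trans (ler_norm_sum _ _ _) _.
  under eq_bigr => x _ do rewrite norm_psi.
  by rewrite sumr_const cardC1 card_Fp // p2.
(* The sums are real, so taking real parts loses nothing. *)
pose kap := fix kap j (c : 'F_p) : R :=
  if j is i.+1 then (2 * p ^ (2 ^ i))%:R - kap i c ^+ 2
  else complex.Re (kloosterman w (c * a) (c * b)).
have p0 : 0 < p%:R :> R by rewrite ltr0n prime_gt0.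
have q0 j : 0 < (p ^ (2 ^ j))%:R :> R by rewrite ltr0n expn_gt0 prime_gt0.
have qS j : (p ^ (2 ^ j.+1))%:R = (p ^ (2 ^ j))%:R ^+ 2 :> R.
  by rewrite -natrX -expnM -expnSr.
(* The sequence starts at level 1: t_0 = (k^2 - 2p) / p with k the original sum, so t_0 <= 2 is
   exactly k^2 <= 4p. *)
pose t n c := - kap n.+1 c / (p ^ (2 ^ n))%:R.
have tS n c : t n.+1 c = t n c ^+ 2 - 2.
  have q1 := q0 n; rewrite /t [kap n.+2 c]/= -/(kap n.+1 c) qS natrM qS.
  by field; rewrite gt_eqF.
have t_ge n c : -2 <= t n c.
  rewrite /t [kap n.+1 c]/= ler_pdivlMr // natrM; have := sqr_ge0 (kap n c); nra.
(* Level n + 2 is the first with exponent at least 4 for every n, and (p + 1)^2 <= p^4. *)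
have small n : (p.+1 ^ 2 <= p ^ (2 ^ n.+2))%N.
  apply: (@leq_trans (p ^ 4)); last first.
    by rewrite leq_exp2l ?prime_gt1 // (@leq_exp2l 2 2 n.+2).
  rewrite (expnM p 2 2) leq_exp2r //; have := prime_gt1 p_pr; rewrite expnS expn1; nia.
have sum_t n : \sum_(c | c != 0) t n.+2 c <= (8 * p + 3)%:R.
  have [E0 chE cardE] := @pPrimePowerField p (2 ^ n.+3) p_pr (expn_gt0 2 _).
  have [|j c|m] := @kloosterman_tower p n.+3 _ w E0 p_pr prim_w chE cardE a b a0 b0
    isT p_odd (small n) (fun j c => real_complex R (kap j c)).
  - by move=> c; rewrite /= RRe_real // kloosterman_real.
  - by rewrite /= rmorphB rmorphXn /= rmorph_nat.
  rewrite -rmorph_sum /= -!(rmorph_nat (real_complex R)) -rmorphB.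
  rewrite -(rmorph1 (real_complex R)) -rmorphD => /complexI sum_kap le_m.
  have -> : \sum_(c | c != 0) t n.+2 c =
      - (\sum_(c | c != 0) kap n.+3 c) / (p ^ (2 ^ n.+2))%:R.
    by rewrite -sumrN mulr_suml.
  rewrite sum_kap ler_pdivrMr // -natrM.
  have : (p ^ (2 ^ n.+3))%:R <=
      (m + (p ^ (2 ^ n.+2) * (4 * p + 3) + 4 * p))%:R :> R by rewrite ler_nat.
  have : ((p ^ (2 ^ n.+2) * (4 * p + 3) + 4 * p)%:R : R) <=
      ((8 * p + 3) * p ^ (2 ^ n.+2))%:R.
    rewrite ler_nat; have : (0 < p ^ (2 ^ n.+2))%N by rewrite expn_gt0 prime_gt0.
    by nia.
  rewrite natrD; lra.
(* The terms with c other than 0 and 1 are at least -2, so the bound on the whole sum bounds the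
   term c = 1. *)
have : t 0%N 1 <= 2.
  apply: (@doubling_bounded _ (t^~ 1) (8 * p + 3 + 2 * p)%:R 2) => // n.
  have := sum_t n; rewrite (bigD1 1) ?oner_neq0 //= -[(2 + n)%N]/n.+2.
  set S := \sum_(_ | _) _.
  have : - (2 * p)%:R <= S.
    apply: (@le_trans _ _ (\sum_(c : 'F_p | (c != 0) && (c != 1)) - 2)).
      rewrite sumr_const -[_ *+ #|_|]mulr_natr natrM mulNr lerN2 ler_pM2l // ler_nat.
      by apply: leq_trans (max_card _) _; rewrite card_Fp.
    by apply: ler_sum => c _; exact: t_ge.
  rewrite [in X in _ -> _ -> X]natrD; lra.
have kr := kloosterman_real a b.
rewrite /t /= expn0 expn1 !mul1r ler_pdivrMr // => le_k.
rewrite -(RRe_real kr); set x := complex.Re _ in le_k *.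
rewrite real_normK ?complex_real // -rmorphXn -(rmorph_nat (real_complex R)) lecR.
by move: le_k; rewrite !natrM; lra.
Qed.
End Weil.

(** * Mean square over windows *)

Lemma sum_Fp (p : nat) (V : nmodType) (g : 'F_p -> V) : prime p ->
  \sum_(0 <= x < p) g x%:R = \sum_y g y.
Proof.
move=> p_pr; transitivity (\sum_(0 <= x < (Zp_trunc (pdiv p)).+2) g x%:R).
  by apply: congr_big_nat => //; rewrite Fp_cast.
by rewrite big_mkord; apply: eq_bigr => y _; rewrite natr_Zp.
Qed.

Lemma sum_nat_lt (p h : nat) (V : nmodType) (g : nat -> V) : (h <= p)%N ->
  \sum_(0 <= x < p) (if (x < h)%N then g x else 0) = \sum_(0 <= x < h) g x.
Proof.
move=> le_hp; rewrite (@big_cat_nat _ _ _ h) //=.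
rewrite [X in _ + X]big_nat [X in _ + X]big1 ?addr0.
  by apply: eq_big_nat => x /andP[_ ->].
by move=> x /andP[/leq_gtF->].
Qed.

Section Fourier.
Variables (R : realType) (p : nat) (w : R[i]).
Hypothesis p_pr : prime p.
Hypothesis prim_w : p.-primitive_root w.
Implicit Types F W : 'F_p -> R[i].

Definition dft F (a : 'F_p) : R[i] := \sum_n F n * psi w (a * n).

Lemma dft_Parseval F :
  \sum_a `|dft F a| ^+ 2 = p%:R * \sum_n `|F n| ^+ 2.
Proof.
have -> : \sum_a `|dft F a| ^+ 2 =
    \sum_a \sum_n \sum_m F n * (F m)^* * psi w (a * (n - m)).
  apply: eq_bigr => a _; rewrite normCK rmorph_sum mulr_suml.
  apply: eq_bigr => n _; rewrite mulr_sumr; apply: eq_bigr => m _.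
  rewrite rmorphM /= conj_psi // mulrBr psiD //; ring.
rewrite exchange_big mulr_sumr; apply: eq_bigr => n _ /=.
rewrite exchange_big (bigD1 n) //= [X in _ + X]big1 ?addr0 => [|m neq_mn].
  by rewrite -mulr_sumr subrr sum_psi // eqxx normCK mulrC.
by rewrite -mulr_sumr sum_psi // subr_eq0 eq_sym (negPf neq_mn) mulr0.
Qed.

(** The transform of the correlation is the product of those of F at a and W at -a; Parseval is used
    before and after. *)
Lemma sum_correlation_le F W (B : R[i]) : (forall a, `|dft F a| ^+ 2 <= B) ->
  \sum_y `|\sum_k F (y + k) * W k| ^+ 2 <= B * \sum_k `|W k| ^+ 2.
Proof.
move=> F_le; set G := fun y => \sum_k F (y + k) * W k.
have p0 : 0 < p%:R :> R[i] by rewrite ltr0n prime_gt0.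
have dftG a : dft G a = dft F a * dft W (- a).
  rewrite /dft /G; under eq_bigr => y _ do rewrite mulr_suml.
  rewrite exchange_big mulr_sumr; apply: eq_bigr => k _.
  rewrite mulr_suml (reindex_inj (addIr (- k))); apply: eq_bigr => y _ /=.
  rewrite subrK mulrBr psiD // mulNr; ring.
rewrite -(ler_pM2l p0) -dft_Parseval mulrCA -dft_Parseval.
rewrite (reindex_inj oppr_inj (F := fun a => `|dft W a| ^+ 2)) mulr_sumr /=.
apply: ler_sum => a _; by rewrite dftG normrM exprMn ler_wpM2r.
Qed.

Variable l : 'F_p.
Hypothesis l0 : l != 0.

Definition kphase (n : nat) : R[i] :=
  if (n%:R : 'F_p) == 0 then 0 else psi w (l / n%:R).

(** The transform at a is the Kloosterman sum K(a, l), covered by Weil's bound if a is nonzero and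
    equal to -1 at a = 0. *)
Lemma dft_kphase (a : 'F_p) :
  `|dft (fun t => if t == 0 then 0 else psi w (l / t)) a| ^+ 2 <= (4 * p)%:R.
Proof.
have -> : dft (fun t => if t == 0 then 0 else psi w (l / t)) a = kloosterman w a l.
  rewrite /dft /kloosterman [RHS]big_mkcond; apply: eq_bigr => t _.
  case: eqP => _ /=; first by rewrite mul0r.
  by rewrite -psiD // addrC.
have [->|a0] := eqVneq a 0; last exact: weil_kloosterman.
have -> : kloosterman w 0 l = -1.
  have E : \sum_(t : 'F_p) psi w (t * l) = 0 by rewrite sum_psi // (negPf l0).
  rewrite (bigD1 0) //= mul0r psi0 in E.
  rewrite /kloosterman (reindex_inj invr_inj) -[RHS]add0r -[X in X + _]E addrAC.
  rewrite subrr add0r.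
  by apply: eq_big => t; rewrite ?invr_eq0 // mul0r add0r invrK mulrC.
by rewrite normrN1 expr1n ler1n muln_gt0 /= prime_gt0.
Qed.

(** The window sum is the correlation with the indicator of the residues below h, whose square norm
    is h because h <= p. *)
Lemma kphase_window h : (h <= p)%N ->
  \sum_(0 <= x < p) `|\sum_(x <= n < x + h) kphase n| ^+ 2 <= (4 * p)%:R * h%:R.
Proof.
move=> le_hp.
pose F t := if t == 0 then 0 else psi w (l / t).
pose W (k : 'F_p) : R[i] := if ((k : nat) < h)%N then 1 else 0.
have valE x : (x < p)%N -> nat_of_ord (x%:R : 'F_p) = x.
  by move=> lt_xp; rewrite val_Fp_nat // modn_small.
have := @sum_correlation_le F W _ dft_kphase.
have -> : \sum_k `|W k| ^+ 2 = h%:R :> R[i].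
  transitivity (\sum_(0 <= x < h) (1 : R[i])); last by rewrite sumr_const_nat subn0.
  rewrite -sum_Fp // -(sum_nat_lt _ le_hp); apply: eq_big_nat => x /andP[_ lt_xp].
  by rewrite /W valE //; case: ifP; rewrite ?normr1 ?normr0 ?expr1n ?expr0n.
apply: le_trans; rewrite -[leRHS]sum_Fp // le_eqVlt; apply/orP; left; apply/eqP.
apply: eq_big_nat => x /andP[_ lt_xp]; congr (`|_| ^+ 2).
have -> : \sum_(x <= n < x + h) kphase n = \sum_(0 <= k < h) kphase (k + x).
  by rewrite -{1}[x]add0n big_addn addKn.
rewrite -[RHS]sum_Fp //.
rewrite -(sum_nat_lt _ le_hp); apply: eq_big_nat => k /andP[_ lt_kp].
rewrite /W valE //; case: ifP => _; last by rewrite mulr0.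
by rewrite mulr1 /kphase /F -natrD addnC.
Qed.
End Fourier.

(** * Dyadic decomposition of intervals *)

(** Cauchy-Schwarz; the induction step uses (n z_i - S)^2 >= 0. *)
Lemma sqr_sum_le (R : realFieldType) (I : Type) (s : seq I) (z : I -> R) :
  (\sum_(i <- s) z i) ^+ 2 <= (size s)%:R * \sum_(i <- s) z i ^+ 2.
Proof.
elim: s => [|i s IHs]; first by rewrite !big_nil expr0n mulr0.
rewrite !big_cons; set S := \sum_(_ <- s) _ in IHs *; set Q := \sum_(_ <- s) _ in IHs *.
have [s0|s_gt0] := posnP (size s).
  by rewrite /S /Q (size0nil s0) !big_nil !addr0 mul1r.
have n0 : 0 < (size s)%:R :> R by rewrite ltr0n.
rewrite /= -natr1; set n := (size s)%:R in IHs n0 *.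
suff : 2 * (z i * S) <= n * z i ^+ 2 + Q by nra.
rewrite -(ler_pM2l n0); have := sqr_ge0 (n * z i - S); nra.
Qed.

Section Smoothing.
Variables (R : rcfType) (V : normedZmodType R) (f : nat -> V).

Definition window x h : V := \sum_(x <= n < x + h) f n.
(** The starts [u <= x < v.+1 - h] are those with [x, x + h) inside [u, v); truncated subtraction
    leaves none when the window is too long. *)
Definition window_sum h u v : V := \sum_(u <= x < v.+1 - h) window x h.
Definition window_energy h u v : R := \sum_(u <= x < v.+1 - h) `|window x h| ^+ 2.

Lemma norm_sum_nat_sqr (F : nat -> V) m n k : (n - m <= k)%N ->
  `|\sum_(m <= x < n) F x| ^+ 2 <= k%:R * \sum_(m <= x < n) `|F x| ^+ 2.
Proof.
move=> le_k.
apply: le_trans (_ : (\sum_(m <= x < n) `|F x|) ^+ 2 <= _).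
  by rewrite lerXn2r ?nnegrE ?sumr_ge0 ?ler_norm_sum.
apply: le_trans (sqr_sum_le _ _) _; rewrite size_iota.
apply: ler_wpM2r; first by apply: sumr_ge0 => x _; exact: sqr_ge0.
by rewrite ler_nat.
Qed.

Lemma sub_sum_nat_le (g : nat -> R) m n m' n' : (forall x, 0 <= g x) ->
  (m <= m')%N -> (n' <= n)%N -> \sum_(m' <= x < n') g x <= \sum_(m <= x < n) g x.
Proof.
move=> g0 le_m le_n; have [le_nm|/ltnW lt_mn] := leqP n' m'.
  by rewrite big_geq // sumr_ge0.
have le_m'n : (m' <= n)%N := leq_trans lt_mn le_n.
rewrite [leRHS](@big_cat_nat _ _ _ m') //=.
rewrite [X in _ + X](@big_cat_nat _ _ _ n') //=.
by rewrite addrCA lerDl addr_ge0 ?sumr_ge0.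
Qed.

Lemma window_energy_ge0 h u v : 0 <= window_energy h u v.
Proof. by apply: sumr_ge0 => x _; exact: sqr_ge0. Qed.

(* Cutting every window of length 2h into two halves, T_2h becomes a sum of
   windows of length h; those that T_2h misses in 2 T_h start less than h away
   from the first or the last admissible position. *)
Lemma window_sum_double h u v :
  `|window_sum h u v *+ 2 - window_sum (2 * h) u v| ^+ 2 <=
    (4 * h)%:R * window_energy h u v.
Proof.
set U := window_energy h u v.
have U0 : 0 <= U := window_energy_ge0 h u v.
have par (x y : V) (X Y : R) : `|x| ^+ 2 <= X -> `|y| ^+ 2 <= Y ->
    `|x + y| ^+ 2 <= 2 * (X + Y).
  move=> xX yY; have := ler_normD x y; have := normr_ge0 (x + y).
  have := sqr_ge0 (`|x| - `|y|); nra.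
have piece m n : (u <= m)%N -> (n <= v.+1 - h)%N -> (n - m <= h)%N ->
    `|\sum_(m <= x < n) window x h| ^+ 2 <= h%:R * U.
  move=> le_m le_n le_h; apply: le_trans (norm_sum_nat_sqr _ le_h) _.
  by rewrite ler_wpM2l // sub_sum_nat_le // => x; exact: sqr_ge0.
have fin : 2 * (h%:R * U + h%:R * U) = (4 * h)%:R * U by rewrite natrM; ring.
rewrite -fin.
(* In the short case no window of length 2h fits, and T_h has at most h terms. *)
have [short|long] := leqP (v.+1 - 2 * h) u.
  rewrite [window_sum (2 * h) u v]big_geq // subr0 mulr2n.
  by apply: (par); apply: piece => //; lia.
have dbl : window_sum (2 * h) u v = \sum_(u <= x < v.+1 - 2 * h) window x h +
    \sum_(u + h <= x < v.+1 - h) window x h.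
  have -> : \sum_(u + h <= x < v.+1 - h) window x h =
      \sum_(u <= x < v.+1 - 2 * h) window (x + h) h.
    by rewrite big_addn; congr (\sum_(_ <= _ < _) _); lia.
  rewrite -big_split; apply: eq_big_nat => x _ /=; rewrite /window.
  rewrite (@big_cat_nat _ _ _ (x + h)) ?leq_addr //=; last by lia.
  by congr (_ + \sum_(_ <= _ < _) _); lia.
have -> : window_sum h u v *+ 2 - window_sum (2 * h) u v =
   \sum_(v.+1 - 2 * h <= x < v.+1 - h) window x h + \sum_(u <= x < u + h) window x h.
  rewrite dbl mulr2n {1}/window_sum (@big_cat_nat _ _ _ (v.+1 - 2 * h)) //=; try lia.
  rewrite /window_sum [X in _ + X - _](@big_cat_nat _ _ _ (u + h)) //=; try lia.
  by rewrite opprD addrACA [_ + _ - _]addrC addKr addrK.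
by apply: par; apply: piece; lia.
Qed.

(** Square root of the previous estimate, divided by 2h: sqrt (4 h V) = 2 h sqrt (V / h). *)
Lemma norm_window_sum_le h u v : (0 < h)%N ->
  `|window_sum h u v| / h%:R <=
    `|window_sum (2 * h) u v| / (2 * h)%:R + Num.sqrt (window_energy h u v / h%:R).
Proof.
move=> h_gt0; have h0 : 0 < h%:R :> R by rewrite ltr0n.
set y := Num.sqrt _; have y0 : 0 <= y by exact: sqrtr_ge0.
have yE : y ^+ 2 * h%:R = window_energy h u v.
  rewrite sqr_sqrtr ?divfK ?gt_eqF //.
  by rewrite divr_ge0 ?window_energy_ge0 ?ltW.
have diff : `|window_sum h u v *+ 2 - window_sum (2 * h) u v| <= 2 * h%:R * y.
  have hy0 : 0 <= 2 * h%:R * y by rewrite !mulr_ge0.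
  rewrite -(@ler_pXn2r _ 2) ?nnegrE //.
  apply: le_trans (window_sum_double _ _ _) _; rewrite -yE natrM le_eqVlt.
  by apply/orP; left; apply/eqP; ring.
have : `|window_sum h u v *+ 2| <= `|window_sum (2 * h) u v| + 2 * h%:R * y.
  rewrite -[X in `|X| <= _](subrK (window_sum (2 * h) u v)).
  by apply: le_trans (ler_normD _ _) _; rewrite addrC lerD2l.
rewrite normrMn -mulr_natl natrM => le2.
rewrite ler_pdivrMr // mulrDl; set t2 := `|window_sum (2 * h) u v| in le2 *.
have -> : t2 / (2 * h%:R) * h%:R = t2 / 2 by field; rewrite gt_eqF.
lra.
Qed.

Lemma interval_sum_sqr_le u v M : (v - u < 2 ^ M)%N ->
  `|\sum_(u <= n < v) f n| ^+ 2 <=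
    M%:R * \sum_(i < M) window_energy (2 ^ i) u v / (2 ^ i)%:R.
Proof.
move=> lt_M; pose y i := Num.sqrt (window_energy (2 ^ i) u v / (2 ^ i)%:R).
have chain k : `|\sum_(u <= n < v) f n| <=
    `|window_sum (2 ^ k) u v| / (2 ^ k)%:R + \sum_(i < k) y i.
  elim: k => [|k IHk].
    rewrite big_ord0 addr0 expn0 divr1 /window_sum subSS subn0.
    by under [in leRHS]eq_bigr => x _ do rewrite /window addn1 big_nat1.
  have k0 : (0 < 2 ^ k)%N by rewrite expn_gt0.
  have := norm_window_sum_le u v k0; rewrite -expnS -/(y k) big_ord_recr /=.
  by move: IHk; lra.
have {chain} := chain M.
have -> : window_sum (2 ^ M) u v = 0.
  by rewrite /window_sum big_geq //; move: lt_M; move: (2 ^ M)%N => q; lia.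
rewrite normr0 mul0r add0r => le_y.
apply: le_trans (_ : (\sum_(i < M) y i) ^+ 2 <= _).
  by rewrite lerXn2r ?nnegrE ?sumr_ge0 // => i _; exact: sqrtr_ge0.
rewrite -(big_mkord xpredT y); apply: le_trans (sqr_sum_le _ _) _.
rewrite size_iota subn0 big_mkord le_eqVlt; apply/orP; left; apply/eqP.
congr (_ * _); apply: eq_bigr => i _.
by rewrite sqr_sqrtr // divr_ge0 ?window_energy_ge0.
Qed.
End Smoothing.

Lemma sum_disjoint_le (R : realFieldType) (J p : nat) (u v : 'I_J -> nat) (g : nat -> R) :
    (forall x, 0 <= g x) -> (forall j, v j <= p)%N ->
    (forall i j x, (u i <= x < v i)%N -> (u j <= x < v j)%N -> i = j) ->
  \sum_j \sum_(u j <= x < v j) g x <= \sum_(0 <= x < p) g x.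
Proof.
move=> g0 le_p disj.
have -> : \sum_j \sum_(u j <= x < v j) g x =
    \sum_j \sum_(0 <= x < p | (u j <= x < v j)%N) g x.
  apply: eq_bigr => j _; 
  rewrite (big_nat_widen _ _ _ _ _ (le_p j)) (big_nat_widenl _ 0) //=.
  by apply: eq_bigl => x; rewrite andbC.
rewrite (exchange_big_dep xpredT) //=; apply: ler_sum => x _.
have [/existsP[j0 xj0]|/existsPn no] := boolP [exists j, (u j <= x < v j)%N].
  rewrite (bigD1 j0) //= big1 ?addr0 // => j /andP[xj].
  by rewrite (disj _ _ _ xj xj0) eqxx.
by rewrite big_pred0 // => j; apply/negbTE/no.
Qed.

(** At each scale the starts lie in disjoint ranges, so the energies add up to at most the mean
    square over [0, p); windows longer than p do not fit. *)
Lemma sum_intervals_sqr_le (R : rcfType) (V : normedZmodType R) (f : nat -> V)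
    (J p M : nat) (u v : 'I_J -> nat) (B : R) :
    (forall h, (h <= p)%N -> \sum_(0 <= x < p) `|window f x h| ^+ 2 <= B * h%:R) ->
    (forall j, v j <= p)%N -> (forall j, v j - u j < 2 ^ M)%N ->
    (forall i j x, (u i <= x < v i)%N -> (u j <= x < v j)%N -> i = j) ->
  0 <= B -> \sum_j `|\sum_(u j <= n < v j) f n| ^+ 2 <= M%:R ^+ 2 * B.
Proof.
move=> wB le_p lt_M disj B0.
apply: le_trans (_ : \sum_j M%:R *
  \sum_(i < M) window_energy f (2 ^ i) (u j) (v j) / (2 ^ i)%:R <= _).
  by apply: ler_sum => j _; exact: interval_sum_sqr_le.
rewrite -mulr_sumr exchange_big expr2 -mulrA; apply: ler_wpM2l => //=.
have -> : M%:R * B = \sum_(i < M) B by rewrite sumr_const card_ord mulr_natl.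
apply: ler_sum => i _; rewrite -mulr_suml ler_pdivrMr ?ltr0n ?expn_gt0 //.
have [le_h|gt_h] := leqP (2 ^ i) p; last first.
  rewrite big1 ?mulr_ge0 // => j _; rewrite /window_energy big_geq //.
  by have := le_p j; lia.
apply: le_trans (wB _ le_h).
apply: (@sum_disjoint_le _ J p u (fun j => (v j).+1 - 2 ^ i)%N) => [x|j|j k x].
- exact: sqr_ge0.
- by have := le_p j; have := expn_gt0 2 i; lia.
- have : (0 < 2 ^ i)%N by rewrite expn_gt0.
  by move=> i0 xj xk; apply: (disj j k x); lia.
Qed.

(** * The exponential sums over short intervals *)

Section Exponential.
Variable R : realType.

Lemma eD (s t : R) : e (s + t) = e s * e t.
Proof.
rewrite /e mulrDr cosD sinD; apply/eqP; rewrite eq_complex /=.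
by rewrite [X in _ && (X == _)]addrC !eqxx.
Qed.

Lemma e_natr (k p : nat) : e (k%:R / p%:R : R) = e (1 / p%:R) ^+ k.
Proof.
elim: k => [|k IHk]; last by rewrite -natr1 mulrDl eD IHk exprSr.
by rewrite mul0r expr0 /e mulr0 cos0 sin0.
Qed.

(** The order divides p, and it is not 1 because 0 < 2 pi / p <= pi and cosine is injective on
    [0, pi]. *)
Lemma e_primitive_root (p : nat) : prime p -> p.-primitive_root (e (1 / p%:R : R)).
Proof.
move=> p_pr; have p0 : p%:R != 0 :> R by rewrite pnatr_eq0 -lt0n prime_gt0.
have wp : e (1 / p%:R : R) ^+ p = 1.
  rewrite -e_natr divff // /e mulr1 mulr_natl cos2pi sin2pi //.
have [m prim_m m_dvd] := prim_order_exists (prime_gt0 p_pr) wp.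
suff m1 : m != 1%N by rewrite -{1}(elimT (prime_nt_dvdP p_pr m1) m_dvd).
apply: contraTneq prim_m => ->; apply/negP => /prim_expr_order.
rewrite expr1 => -[cos1 _].
have pi0 := pi_gt0 R; have p2 : 2 <= p%:R :> R by rewrite ler_nat prime_gt1.
have p_gt0 : 0 < p%:R :> R by lra.
have x0 : 0 <= 2 * pi * (1 / p%:R) :> R by rewrite mul1r divr_ge0 ?mulr_ge0 ?ltW.
have x1 : 2 * pi * (1 / p%:R) <= pi :> R by rewrite mul1r ler_pdivrMr //; nra.
have : 2 * pi * (1 / p%:R) = 0 :> R.
  apply: (@cos_inj R); last by rewrite cos0.
    by rewrite in_itv /= x0 x1.
  by rewrite in_itv /= lexx ltW.
move/eqP; rewrite mul1r !mulf_eq0 invr_eq0 (gt_eqF pi0) (negPf p0) orbF orbF.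
by rewrite pnatr_eq0.
Qed.
End Exponential.

(** Take the least and greatest integers u and m in I: [u, m] lies in I, so m - u <= H, and the
    half-open range has m - u + 1 elements. *)
Lemma interval_nat_range (R : realType) (p : nat) (I : set R) (H : R) :
    is_interval I -> I `<=` [set x | 0 < x < p%:R] -> 0 <= H ->
    (lebesgue_measure I <= H%:E)%E ->
  exists uv : nat * nat, [/\ (uv.2 <= p)%N,
    forall n, (1 <= n < p)%N -> ((n%:R : R) \in I) = (uv.1 <= n < uv.2)%N,
    (0 < uv.1)%N & (uv.2 - uv.1)%N%:R <= H + 1].
Proof.
move=> itvI sub H0 leH.
pose P n := (1 <= n < p)%N && ((n%:R : R) \in I).
have [exP|noP] := pselect (exists n, P n); last first.
  (* Without integers in I, any empty range with positive left end serves. *)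
  exists (1%N, 0%N); split => //=; last by rewrite addr_ge0.
  move=> n np; rewrite ltn0 andbF; apply/negbTE/negP => nI.
  by apply: noP; exists n; apply/andP.
have ltP n : P n -> (n <= p)%N by case/andP => /andP[_ /ltnW].
pose u := ex_minn exP; pose m := ex_maxn exP ltP.
have Pu : P u by rewrite /u; case: ex_minnP.
have Pm : P m by rewrite /m; case: ex_maxnP.
have leu n : P n -> (u <= n)%N by rewrite /u; case: ex_minnP => k _; exact.
have lem n : P n -> (n <= m)%N by rewrite /m; case: ex_maxnP => k _; exact.
exists (u, m.+1); split => /=.
- by case/andP: Pm => /andP[].
- move=> n np; apply/idP/idP => [nI|/andP[un nm]].
    have Pn : P n by rewrite /P np nI.
    by rewrite (leu n Pn) ltnS (lem n Pn).
  case/andP: Pu => _; case/andP: Pm => _; rewrite !inE => Im Iu.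
  by apply: (itvI _ _ Iu Im); rewrite !ler_nat un -ltnS nm.
- by case/andP: Pu => /andP[].
have um : (u <= m)%N := leu _ Pm.
rewrite subSn // -natr1 lerD2r natrB //.
rewrite -lee_fin; apply: le_trans leH.
have -> : (m%:R - u%:R)%:E = lebesgue_measure `[u%:R : R, m%:R].
  rewrite lebesgue_measure_itv /= lte_fin ltr_nat; case: ltnP => [_|le_mu].
    by rewrite EFinB.
  by rewrite (@anti_leq m u) ?subrr // le_mu um.
apply: le_measure; rewrite ?inE //.
  exact: measurable_realfun.is_interval_measurable.
case/andP: Pu => _; case/andP: Pm => _; rewrite !inE => Im Iu x /=.
by rewrite in_itv /= => /andP[ux xm]; apply: (itvI _ _ Iu Im); rewrite ux.
Qed.

Section IntervalFamily.
Variables (R : realType) (p : nat) (J : nat) (u v : 'I_J -> nat) (ell : 'F_p).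
Hypothesis p_pr : prime p.
Hypothesis ell0 : ell != 0.
Hypothesis le_p : forall j, (v j <= p)%N.
Hypothesis disj : forall i j x, (u i <= x < v i)%N -> (u j <= x < v j)%N -> i = j.

(** [Rcomplex R] gives the complex numbers the real-valued norm [cabs], as the smoothing estimates
    require. *)
Let f : nat -> Rcomplex R := kphase (e (1 / p%:R)) ell.

Lemma sum_kphase_sqr_le M : (forall j, v j - u j < 2 ^ M)%N ->
  \sum_j cabs (\sum_(u j <= n < v j) f n) ^+ 2 <= M%:R ^+ 2 * (4 * p)%:R.
Proof.
move=> lt_M; apply: (@sum_intervals_sqr_le R (Rcomplex R) f J p M u v) => // h le_h.
rewrite -lecR rmorph_sum rmorphM !rmorph_nat /=.
apply: le_trans (kphase_window p_pr (e_primitive_root R p_pr) ell0 le_h).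
by under [leLHS]eq_bigr => x _ do rewrite rmorphXn.
Qed.

(** Cauchy-Schwarz on each range, with all terms of modulus at most 1; the disjoint ranges contain
    at most p integers together. *)
Lemma sum_kphase_sqr_le_trivial N : (forall j, v j - u j <= N)%N ->
  \sum_j cabs (\sum_(u j <= n < v j) f n) ^+ 2 <= (N * p)%:R.
Proof.
move=> le_N.
have f_le n : cabs (f n) ^+ 2 <= 1.
  rewrite -lecR rmorphXn rmorph1 /= -[real_complex R _]/`|kphase _ _ _| /kphase.
  case: ifP => _; first by rewrite normr0 expr0n.
  by rewrite (norm_psi p_pr (e_primitive_root R p_pr)) expr1n.
apply: le_trans (_ : \sum_j \sum_(u j <= n < v j) N%:R <= _).
  apply: ler_sum => j _.
  apply: le_trans (@norm_sum_nat_sqr R (Rcomplex R) f _ _ _ (le_N j)) _.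
  rewrite mulr_sumr; apply: ler_sum => n _; rewrite -[leRHS]mulr1.
  by apply: ler_wpM2l => //; exact: f_le.
apply: le_trans (@sum_disjoint_le R J p u v (fun=> N%:R) _ le_p disj) _ => //.
by rewrite sumr_const_nat subn0 natrM mulr_natr.
Qed.
End IntervalFamily.

(** From exp (-1/2) >= 1 - 1/2 follows exp (1/2) <= 2. *)
Lemma ln2_ge (R : realType) : 1 / 2 <= ln (2 : R).
Proof.
rewrite -ler_expR lnK ?posrE //.
have := expR_ge1Dx (- (1 / 2) : R); rewrite expRN => le_inv.
have e0 : 0 < expR (1 / 2 : R) := expR_gt0 _.
have : expR (1 / 2 : R) * (expR (1 / 2))^-1 = 1 by rewrite divff // gt_eqF.
by nra.
Qed.

(** [hH] keeps H away from 1, where the right side vanishes although an interval of length at most 1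
    may contain an integer. *)
Theorem theorem2 (R : realType) (p : nat) (hp : prime p)
    (H : R) (hH : 1 / 32 <= `| ln H |)
    (J : nat) (I : 'I_J -> set R)
    (I_itv : forall j, is_interval (I j))
    (I_sub : forall j, I j `<=` [set x | 0 < x < p%:R])
    (I_disj : trivIset [set: 'I_J] I)
    (I_len : forall j, ((H / 2)%:E < lebesgue_measure (I j) <= H%:E)%E)
    (ell : 'F_p) (hell : ell \is a GRing.unit) :
  \sum_(j < J) cabs (short_kloosterman ell (I j)) ^+ 2
    <= 2 ^+ 12 * p%:R * ln H ^+ 2.
Proof.
have ell0 : ell != 0 by rewrite -unitfE.
have rhs0 : 0 <= 2 ^+ 12 * p%:R * ln H ^+ 2.
  apply: mulr_ge0; last exact: sqr_ge0.
  by apply: mulr_ge0 => //; exact: exprn_ge0.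
(* For H <= 0 the length condition is contradictory, so there are no intervals. *)
have [H0|H0] := leP H 0.
  rewrite big1 // => j _; have /andP[lt1 le1] := I_len j.
  have := lt_le_trans lt1 le1; have := measure_ge0 lebesgue_measure (I j).
  by move=> /le_trans/(_ le1); rewrite lee_fin lte_fin; lra.
have /choice[uv uvP] j := interval_nat_range (I_itv j) (@I_sub j) (ltW H0)
  (proj2 (andP (I_len j))).
pose u j := (uv j).1; pose v j := (uv j).2.
have le_p j : (v j <= p)%N by case: (uvP j).
have disj i j x : (u i <= x < v i)%N -> (u j <= x < v j)%N -> i = j.
  move=> xi xj; have [_ memi u0 _] := uvP i; have [_ memj _ _] := uvP j.
  have xp : (1 <= x < p)%N.
    case/andP: xi => ux xv; rewrite (leq_trans u0 ux) /=.
    exact: leq_trans xv (le_p i).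
  apply: I_disj => //; exists x%:R; split; rewrite -in_setE ?memi ?memj //.
have skE j : short_kloosterman ell (I j) =
    \sum_(u j <= n < v j) kphase (e (1 / p%:R)) ell n.
  have [_ memj u0 _] := uvP j.
  rewrite /short_kloosterman [RHS](big_nat_widen _ _ _ _ _ (le_p j)).
  rewrite [RHS](big_nat_widenl _ 1) //.
  rewrite [LHS]big_nat_cond [RHS]big_nat_cond; apply: eq_big => [n|n /andP[np _]].
    have [np|//] := boolP (1 <= n < p)%N.
    by rewrite memj //= andbC.
  rewrite e_natr /kphase; case: eqP => // n0.
  case/andP: np => n_gt0 n_lt; move/eqP: n0.
  by rewrite -(dvdn_pcharf (pchar_Fp hp)) gtnNdvd.
under eq_bigr => j _ do rewrite skE.
have lenE j : (v j - u j)%N%:R <= H + 1 by case: (uvP j).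
(* For H < 2 each range has fewer than 3 integers, and the trivial bound 2p is below 2^12 (1/32)^2 p
   = 4p. *)
have [H2|H2] := ltP H 2.
  apply: le_trans (@sum_kphase_sqr_le_trivial R p J u v ell hp le_p disj 2 _) _.
    move=> j; rewrite -ltnS -(ltr_nat R); have := lenE j; lra.
  have : (1 / 32) ^+ 2 <= ln H ^+ 2.
    by rewrite -[leRHS]real_normK ?num_real // lerXn2r ?nnegrE.
  rewrite natrM; have : 0 <= p%:R :> R by []; nra.
have lnH : 1 / 2 <= ln H by apply: le_trans (ln2_ge R) _; rewrite ler_ln ?posrE.
(* K + 1 dyadic scales suffice: range lengths are at most the integer part of H + 1, which is below
   2^(K + 1). *)
pose K := trunc_log 2 (Num.truncn (H + 1)).
have H1 : 0 <= H + 1 by lra.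
have tr_gt0 : (0 < Num.truncn (H + 1))%N by rewrite truncn_gt0; lra.
have lt_K j : (v j - u j < 2 ^ K.+1)%N.
  apply: leq_ltn_trans (trunc_log_ltn _ _) => //.
  rewrite -ltnS -(ltr_nat R); apply: le_lt_trans (lenE j) _.
  exact: Num.Theory.truncnS_gt.
apply: le_trans (@sum_kphase_sqr_le R p J u v ell hp ell0 le_p disj K.+1 lt_K) _.
(* For H >= 2, 2^K <= H + 1 <= H^2. *)
have leK : K%:R * ln 2 <= 2 * ln H.
  have pw : (2 : R) ^+ K <= H ^+ 2.
    apply: (@le_trans _ _ (H + 1)); last by nra.
    apply: (@le_trans _ _ (Num.truncn (H + 1))%:R); last by rewrite truncn_le.
    by rewrite -natrX ler_nat; exact: trunc_logP.
  move: pw; rewrite -ler_ln ?posrE ?exprn_gt0 // !lnXn //; lra.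
have ln2 := ln2_ge R.
have K0 : 0 <= K%:R :> R by [].
(* K <= 4 ln H and 1 <= 2 ln H, both from ln 2 >= 1/2. The total is then at most 4 * 36 p (ln H)^2,
   well below the constant 2^12. *)
have leK6 : K.+1%:R <= 6 * ln H by rewrite -natr1; nra.
have K1 : 0 <= K.+1%:R :> R by [].
have p0 : 0 <= p%:R :> R by [].
rewrite natrM mulrA [leRHS]mulrAC; apply: ler_wpM2r => //.
rewrite -natrX; nra.
Qed.
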